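(* Assume that $\eta_0>0$ and $\theta_0>0$. Let $J$ be the function defined in the context and let $\bar J:\mathbb R\to[0,+\infty]$ be defined by $\bar J(m)=J(m)$ for $m\neq 0$ and $\bar J(0)=\min(J(0),\theta_0)$. (i) If $\eta_0=+\infty$ (in particular if $W$ is bounded), then $(Z_t/t)_{t\ge 0}$ satisfies a full large deviation principle (with speed $t$, as $t\to\infty$) with good rate function $\bar J$. (ii) If $\eta_0<+\infty$, then, denoting $m=\mathbb E(W)/\mathbb E(\tau)$, for all $a>0$ and all $\kappa\in(0,1)$, $$\limsup_{t\to\infty}\frac1t\log\mathbb P\left(\frac{Z_t}{t}\ge m+a\right)\le -\min\left[\inf_{z\ge m+\kappa a}\bar J(z)\,,\ \frac{\eta_0\,a(1-\kappa)}{4}\right],$$ and similarly $$\limsup_{t\to\infty}\frac1t\log\mathbb P\left(\frac{Z_t}{t}\le m-a\right)\le -\min\left[\inf_{z\le m-\kappa a}\bar J(z)\,,\ \frac{\eta_0\,a(1-\kappa)}{4}\right].$$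
   Context: Setting. $(\tau_i,W_i)_{i\ge1}$ is an i.i.d. sequence of pairs of random variables on a probability space $(\Omega,\mathcal F,\mathbb P)$, with common law $\psi$, an arbitrary probability measure on $(0,+\infty)\times\mathbb R$ (so $0<\tau_i<+\infty$ almost surely; $\tau_i$ and $W_i$ may be dependent). $(\tau,W)$ denotes a generic pair with law $\psi$. Put $S_0=0$, $S_n=\sum_{i=1}^n\tau_i$, $M_t=\sup\{n\ge0: S_n\le t\}$ and $Z_t=\sum_{i=1}^{M_t}W_i$ (an empty sum is $0$). Define, in $[0,+\infty]$, $$\theta_0=\sup\{\theta\ge0:\ \mathbb E[e^{\theta\tau}]<\infty\},\qquad \eta_0=\sup\{\eta\ge0:\ \mathbb E[e^{\eta|W|}]<\infty\}.$$ For $(a,b)\in\mathbb R^2$ let $\Lambda^*(a,b)=\sup_{(x,y)\in\mathbb R^2}\{ax+by-\log\mathbb E(e^{x\tau+yW})\}$, and for $m\in\mathbb R$ let $$J(m)=\inf_{\beta>0}\beta\,\Lambda^*\left(\frac1\beta,\frac m\beta\right)=\inf_{\beta>0}\ \sup_{(x,y)\in\mathbb R^2}\left\{x+my-\beta\log\mathbb E\left(e^{x\tau+yW}\right)\right\}.$$ Large deviations. A family of real random variables $(Y_t)_{t\ge0}$ satisfies a full large deviation principle (LDP) with rate function $R$ if $R:\mathbb R\to[0,+\infty]$ is lower semi-continuous, $\liminf_{t\to\infty}\frac1t\log\mathbb P(Y_t\in O)\ge-\inf_{O}R$ for every open $O\subset\mathbb R$, and $\limsup_{t\to\infty}\frac1t\log\mathbb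 P(Y_t\in C)\le-\inf_C R$ for every closed $C\subset\mathbb R$. The rate function is good if all its level sets $\{R\le a\}$, $a\in[0,\infty)$, are compact. Conventions: $\log 0=-\infty$, $\inf\emptyset=+\infty$. *)

(* Defs.v *)
From HB Require Import structures.
From mathcomp Require Import all_boot all_order all_algebra finmap.
From mathcomp Require Import all_classical all_reals all_analysis.
Set Implicit Arguments.
Unset Strict Implicit.
Unset Printing Implicit Defensive.
Import Order.TTheory GRing.Theory Num.Theory.
Import numFieldNormedType.Exports.
Local Open Scope classical_set_scope.
Local Open Scope ring_scope.

Section iid.
Context d d' (Omega : measurableType d) (T : measurableType d') (R : realType)
  (P : probability Omega R).

Definition mutually_independent (X : nat -> {RV P >-> T}) : Prop :=
  forall (I : {fset nat}) (A : nat -> set T),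
    (forall i, i \in I -> measurable (A i)) ->
    P (\bigcap_(i in [set` I]) (X i @^-1` A i)) =
    (\prod_(i <- I) P (X i @^-1` A i))%E.

Definition iid_with_law (psi : probability T R) (X : nat -> {RV P >-> T}) :
    Prop :=
  mutually_independent X /\
  forall i (A : set T), measurable A -> distribution P (X i) A = psi A.

End iid.

Section large_deviations.
Context d (Omega : measurableType d) (R : realType) (P : probability Omega R).
Local Open Scope ereal_scope.

(* (1/t) log P(E_t), with log 0 = -oo *)
Definition log_prob_rate (E : R -> set Omega) (t : R) : \bar R :=
  (t^-1)%:E * lne (P (E t)).

Definition limsup_log_prob (E : R -> set Omega) : \bar R :=
  limf_esup (log_prob_rate E) (pinfty_nbhs R).

Definition liminf_log_prob (E : R -> set Omega) : \bar R :=
  limf_einf (log_prob_rate E) (pinfty_nbhs R).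

Definition full_LDP (Y : R -> Omega -> R) (rate : R -> \bar R) : Prop :=
  [/\ forall z, 0 <= rate z,
      lower_semicontinuous rate,
      forall O : set R, open O ->
        - ereal_inf (rate @` O) <= liminf_log_prob (fun t => Y t @^-1` O) &
      forall C : set R, closed C ->
        limsup_log_prob (fun t => Y t @^-1` C) <= - ereal_inf (rate @` C)].

Definition good_rate (rate : R -> \bar R) : Prop :=
  forall a : R, (0 <= a)%R -> compact [set z | rate z <= a%:E].

End large_deviations.

(* The generic pair (tau, W) is realised as the two coordinate projections on
   the probability space (R * R, psi). *)
Section law_functionals.
Context (R : realType) (psi : probability (R * R)%type R).
Local Open Scope ereal_scope.

Definition theta0 : \bar R :=
  ereal_sup [set theta%:E | theta in
    [set theta : R | (0 <= theta)%R /\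
       'E_psi[fun z => expR (theta * z.1)] < +oo]].

Definition eta0 : \bar R :=
  ereal_sup [set eta%:E | eta in
    [set eta : R | (0 <= eta)%R /\
       'E_psi[fun z => expR (eta * `|z.2|)] < +oo]].

Definition Lambda (x y : R) : \bar R :=
  lne 'E_psi[fun z => expR (x * z.1 + y * z.2)].

Definition Lambda_star (a b : R) : \bar R :=
  ereal_sup [set (a * u.1 + b * u.2)%:E - Lambda u.1 u.2 |
              u in [set: (R * R)%type]].

Definition J (m : R) : \bar R :=
  ereal_inf [set beta%:E * Lambda_star (1 / beta) (m / beta) |
              beta in [set beta : R | (0 < beta)%R]].

Definition Jbar (m : R) : \bar R :=
  if m == 0%R then mine (J 0%R) theta0 else J m.

End law_functionals.

(* The sequence is indexed from 0: [X i] is the pair (tau_(i+1), W_(i+1)). *)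
Section renewal_reward.
Context (Omega : Type) (R : realType) (X : nat -> Omega -> R * R).

Definition renewal_time (n : nat) (w : Omega) : R := \sum_(i < n) (X i w).1.

(* [supremum 0] takes the value 0 when the set is unbounded; for positive
   i.i.d. tau_i this only happens on a null event, where M_t is infinite. *)
Definition renewal_count (t : R) (w : Omega) : nat :=
  supremum 0%N [set n : nat | renewal_time n w <= t].

Definition reward (t : R) (w : Omega) : R :=
  \sum_(i < renewal_count t w) (X i w).2.

End renewal_reward.

(* Main.v *)
Require Import Defs.
From HB Require Import structures.
From mathcomp Require Import all_boot all_order all_algebra finmap.
From mathcomp Require Import all_classical all_reals all_analysis.
From mathcomp Require Import measurable_realfun.
From mathcomp Require Import ring lra zify.
Import Order.TTheory GRing.Theory Num.Theory.
Import numFieldNormedType.Exports.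
Import HBNNSimple HBSimple.
Local Open Scope classical_set_scope.
Local Open Scope ring_scope.
Set Implicit Arguments.
Unset Strict Implicit.
Unset Printing Implicit Defensive.

(** Write mgf x y = E exp (x tau + y W). The proof replaces the double extremum
    that defines J by the supremum of a linear form over a convex level set,
    the function
      cost z = sup { x + z y : mgf x y <= 1 }.
    It is a supremum of affine functions of z, some of positive and some of
    negative slope, hence convex and lower semicontinuous with compact level
    sets; and it is bounded by J because
    beta (Lambda_star (1/beta, z/beta)) dominates x + z y as soon as
    Lambda x y <= 0. In the other direction the constraint Lambda <= 0 is
    satisfied strictly at (-1, 0), so that a Lagrange multiplier beta >= 0
    exists ([cost_multiplier]): x + z y <= cost z + beta Lambda x y. If
    beta > 0 this says J z <= cost z. If beta = 0, the linear form x + z y is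
    bounded by cost z on the whole domain of Lambda; when eta0 is infinite this
    is only possible for z = 0, and then theta0 <= cost 0. Hence the
    regularised rate function is cost itself when eta0 is infinite
    ([Jbar_cost]). When eta0 is finite, it is enough that J is at most cost z
    at the points of the segment from z to m = E W / E tau other than z
    ([J_segment_le]): there the multiplier becomes positive, by Jensen.

    Upper bound. On the event that n renewals have occurred at time t, one has
    S_n <= t < S_(n+1), and
      exp (x (S_n - t) + y (Z_t - z t)) (1 + exp (x tau_(n+1))) >= 1
    as soon as y (Z_t - z t) >= 0. Taking expectations and summing over n gives
    a bound C exp (- (x + z y) t), provided mgf x y < 1 and
    E exp (x tau) is finite ([upper_exponential_bound]). Points of the level
    set need not have E exp (x tau) finite, but shrinking them towards the
    origin by the factor eta / (eta + |y|), eta < eta0, restores this by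
    Young's inequality ([mgf_young]). If eta0 is infinite the factor is
    arbitrarily close to 1 and nothing is lost. If it is finite, the loss is
    compensated by moving the target z back towards m by b, as long as the rate
    stays below eta0 b ([exp_decay_half_line]); b = a (1 - kappa) / 4 gives
    the tail estimate.

    Lower bound. If phi is a density with respect to the law psi, under which
    W - z tau is centred and which is at most exp (c tau + y (W - z tau)), then
    the velocity Z_t / t is close to z with probability at least
    exp (- (c + o(1)) t): under the product of the densities phi the random
    walk (S_n, V_n) of the partial sums of tau and W stays close to its mean
    line by Chernoff bounds, and there the product of the densities is at most
    about exp (c t) ([prob_near_ge_of_density]). For c > cost z such a density is found among
    the exponential tilts of the law restricted to a large box: c > cost z
    means that y |-> E exp (c tau + y (W - z tau)) exceeds 1 everywhere; by
    compactness this persists in a large box, and the minimiser over y of the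
    truncated function is a centred tilt ([box_mass_minimizer],
    [minimizer_mean0]). This requires W - z tau to take both signs, which can
    be arranged by moving z slightly towards m ([tilt_var_both_signs]); at m
    itself the untilted law will do. *)

(** * Expectations of products of independent variables *)

Section products.
Context d d' (Omega : measurableType d) (T : measurableType d') (R : realType).
Context (P : probability Omega R) (psi : probability T R).

(** The identity extends from indicators to nonnegative measurable functions by
    approximation with simple functions and monotone convergence. In the use
    below G is a product of functions of the other variables. *)
Lemma integral_mul_comp_indic (G : Omega -> R) (X : {RV P >-> T}) (C : R) :
  measurable_fun setT G -> (forall w, 0 <= G w) -> 0 <= C ->
  (forall A, measurable A ->
    (\int[P]_w (G w * \1_A (X w))%:E = C%:E * psi A)%E) ->
  forall f : T -> R, measurable_fun setT f -> (forall x, 0 <= f x) ->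
  (\int[P]_w (G w * f (X w))%:E = C%:E * \int[psi]_x (f x)%:E)%E.
Proof.
move=> mG G0 C0 GX f mf f0.
have mX : measurable_fun setT X by [].
have mEf : measurable_fun setT (EFin \o f) by exact/measurable_EFinP.
pose h := nnsfun_approx measurableT mEf.
have hcv x : (h n x)%:E @[n --> \oo] --> (f x)%:E.
  by apply: (cvg_nnsfun_approx measurableT mEf) => // y _; rewrite lee_fin.
have hnd x : {homo (fun n => (h n x)%:E) : n m / (n <= m)%N >-> (n <= m)%E}.
  move=> n m nm; rewrite lee_fin.
  by have /lefP := @nd_nnsfun_approx _ _ _ _ measurableT _ mEf _ _ nm; apply.
have mhX n : measurable_fun setT (fun w => (G w * h n (X w))%:E).
  apply/measurable_EFinP/measurable_funM => //.
  exact: measurableT_comp.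
have Hn n : (\int[P]_w (G w * h n (X w))%:E = C%:E * \int[psi]_x (h n x)%:E)%E.
  have -> : (fun w => (G w * h n (X w))%:E) =
    (fun w => \sum_(y \in range (h n))
       (y%:E * (G w * \1_(h n @^-1` [set y]) (X w))%:E))%E.
    apply/funext => w; rewrite (fimfunE (h n)) mulrC.
    rewrite fsbig_finite//= [in RHS]fsbig_finite//= mulr_suml -sumEFin.
    by apply: eq_bigr => y _; rewrite -EFinM; congr EFin; ring.
  have mGI y : measurable_fun setT
      (fun w => (G w * \1_(h n @^-1` [set y]) (X w))%:E).
    apply/measurable_EFinP/measurable_funM => //.
    by apply: measurableT_comp mX; exact: measurable_indic.
  have yi0 y w : (0 <= y%:E * (G w * \1_(h n @^-1` [set y]) (X w))%:E)%E.
    have [y0|y0] := leP 0 y.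
      by rewrite -EFinM lee_fin !mulr_ge0.
    rewrite [X in \1_X]preimage_nnfun0//.
    by rewrite indic0 mulr0 mule0.
  rewrite ge0_integral_fsum//; last first.
    by move=> y; apply: emeasurable_funM => //; exact: measurable_cst.
  rewrite integralT_nnsfun sintegralE.
  have [F Fe] : exists F : seq R, forall g : R -> \bar R,
     (\sum_(y \in range (h n)) g y = \sum_(y <- F) g y)%E.
    exists (fset_set (range (h n))) => g.
    by rewrite fsbig_finite.
  rewrite !Fe.
  rewrite ge0_sume_distrr; last by move=> y _; apply: nnsfun_mulemu_ge0.
  apply: eq_bigr => y _.
  have [y0|y0] := leP 0 y.
    rewrite ge0_integralZl_EFin//; first by rewrite GX// !muleA (muleC y%:E).
    by move=> w _; rewrite lee_fin mulr_ge0.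
  rewrite !preimage_nnfun0//.
  rewrite measure0 !mule0.
  apply: integral0_eq => w _.
  by rewrite indic0 mulr0 mule0.
have cv1 : (\int[P]_w (G w * h n (X w))%:E)%E @[n --> \oo] -->
           (\int[P]_w (G w * f (X w))%:E)%E.
  have := @cvg_monotone_convergence _ _ _ P setT measurableT
    (fun n w => (G w * h n (X w))%:E) mhX.
  have -> : (fun w => limn ((fun n w => (G w * h n (X w))%:E)^~ w)) =
            (fun w => (G w * f (X w))%:E).
    apply/funext => w; apply/cvg_lim => //.
    have := cvgeZl (y := (G w)%:E) _ (hcv (X w)).
    rewrite /= => /(_ isT); by under eq_fun do rewrite -EFinM.
  apply.
  - by move=> n w _; rewrite lee_fin mulr_ge0.
  - move=> w _ n m nm; have := hnd (X w) n m nm; rewrite !lee_fin => nmw.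
    exact: ler_wpM2l.
have cv2 : (\int[psi]_x (h n x)%:E)%E @[n --> \oo] --> (\int[psi]_x (f x)%:E)%E.
  have := @cvg_monotone_convergence _ _ _ psi setT measurableT
    (fun n x => (h n x)%:E).
  have -> : (fun w => limn ((fun n w => (h n w)%:E)^~ w)) =
            (fun w => (f w)%:E).
    by apply/funext => w; apply/cvg_lim => //; exact: hcv.
  apply.
  - by move=> n; apply/measurable_EFinP.
  - by move=> n w _; rewrite lee_fin.
  - by move=> w _; exact: hnd.
rewrite (eq_cvg _ _ Hn) in cv1.
by apply: cvg_unique cv1 _ => //; exact: cvgeZl.
Qed.

Context (X : nat -> {RV P >-> T}) (X_iid : iid_with_law psi X).

(** The factors are replaced one at a time, from indicators to general
    functions; the case of indicators only is mutual independence. *)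
Lemma expectation_prod_iid (N : nat) (f : nat -> T -> R) :
  (forall i, measurable_fun setT (f i)) -> (forall i x, 0 <= f i x) ->
  (forall i, \int[psi]_x (f i x)%:E < +oo)%E ->
  (\int[P]_w (\prod_(i < N) f i (X i w))%:E =
   \prod_(i < N) \int[psi]_x (f i x)%:E)%E.
Proof.
move=> mf f0 foo.
suff H : forall n, (n <= N)%N -> forall (g : nat -> T -> R), (forall i, measurable_fun setT (g i)) ->
    (forall i x, 0 <= g i x) -> (forall i, \int[psi]_x (g i x)%:E < +oo)%E ->
    (forall i, (n <= i)%N -> exists2 A, measurable A & g i = \1_A) ->
   (\int[P]_w (\prod_(i < N) g i (X i w))%:E =
   \prod_(i < N) \int[psi]_x (g i x)%:E)%E.
  pose g i := if (i < N)%N then f i else \1_setT.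
  have Hg : (\int[P]_w (\prod_(i < N) g i (X i w))%:E =
      \prod_(i < N) \int[psi]_x (g i x)%:E)%E; last first.
    move: Hg; under eq_integral do under eq_bigr do rewrite /g ltn_ord.
    by under [in RHS]eq_bigr do rewrite /g ltn_ord.
  apply: (H N (leqnn N) g); rewrite /g.
  - by move=> i; case: ifP => // _; apply: measurable_indic.
  - by move=> i x; case: ifP.
  - move=> i; case: ifP => // _.
    by rewrite integral_indic// setIT (le_lt_trans (probability_le1 _ _))// ltry.
  - by move=> i; rewrite leqNgt => /negbTE ->; exists setT.
move=> {f mf f0 foo}; elim => [|n IH] nN g mg g0 goo gA.
  have [A mA gE] : exists2 A : nat -> set T, (forall i, measurable (A i)) &
      (forall i, g i = \1_(A i)).
    have /choice[A HA] : forall i, exists A, measurable A /\ g i = \1_A.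
      by move=> i; have [//|A] := gA i; exists A.
    by exists A => i; have [] := HA i.
  under eq_integral do under eq_bigr do rewrite gE.
  under [in RHS]eq_bigr do (rewrite gE integral_indic// setIT).
  have -> : (fun w => (\prod_(i < N) (\1_(A i) (X i w) : R))%:E) =
    (fun w => (\1_(\bigcap_(i in [set` [fset k | k in iota 0 N]%fset])
                  (X i @^-1` A i)) w)%:E).
    apply/funext => w; congr EFin.
    rewrite indicE; case: (boolP (w \in _)).
      rewrite inE => H; rewrite big1// => i _.
      rewrite indicE mem_set//; apply: H => /=.
      by rewrite !inE/= mem_iota/=.
    move=> H /=.
    have [i iN nA] : exists2 i, (i < N)%N & ~ (A i (X i w)).
      apply: contrapT => H1; move/negP: H; apply; rewrite inE => i /=.
      rewrite !inE/= mem_iota/= add0n => iN.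
      by apply: contrapT => ?; apply: H1; exists i.
    rewrite (bigD1 (Ordinal iN))//= indicE memNset ?mul0r//.
  have [X1 X2] := X_iid.
  have mXA i : measurable (X i @^-1` A i).
    by rewrite -[_ @^-1` _]setTI; exact: measurable_funPT.
  rewrite integral_indic ?setIT//; last first.
    by apply: bigcap_measurableType => // i _; exact: mXA.
  pose I := [fset k | k in iota 0 N]%fset.
  rewrite [LHS](X1 I A)//.
  rewrite (perm_big (iota 0 N)); last first.
    apply: uniq_perm; [exact: fset_uniq|exact: iota_uniq|].
    by move=> k; rewrite !inE/=.
  rewrite -{1}(subn0 N) -/(index_iota 0 N) big_mkord.
  by apply: eq_bigr => i _; exact: (X2 i _ (mA i)).
pose G w := \prod_(i < N | i != Ordinal nN) g i (X i w).
pose C := fine (\prod_(i < N | i != Ordinal nN) \int[psi]_x (g i x)%:E)%E.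
have Cfin : (\prod_(i < N | i != Ordinal nN) \int[psi]_x (g i x)%:E)%E = C%:E.
  rewrite fineK//; elim/big_ind : _ => //; first by move=> *; exact: fin_numM.
  by move=> i _; rewrite ge0_fin_numE// integral_ge0// => x _; rewrite lee_fin.
have mG : measurable_fun setT G.
  rewrite (_ : G = fun w => \prod_(i < N)
      (if i != Ordinal nN then g i (X i w) else 1)); last first.
    by apply/funext => w; exact: big_mkcond.
  apply: measurable_prod => i _; case: (i != Ordinal nN) => //.
  exact: measurableT_comp.
have := @integral_mul_comp_indic G (X n) C mG _ _ _ (g n) (mg n) (g0 n).
rewrite (bigD1 (Ordinal nN))//= Cfin muleC => <-.
- apply: eq_integral => w _; congr EFin.
  by rewrite (bigD1 (Ordinal nN))//= mulrC.
- by move=> w; apply: prodr_ge0.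
- rewrite -lee_fin -Cfin; apply: prode_ge0 => i _.
  by apply: integral_ge0 => x _; rewrite lee_fin.
move=> A mA.
pose g' i := if i == n then \1_A : T -> R else g i.
have : (\int[P]_w (\prod_(i < N) g' i (X i w))%:E =
      \prod_(i < N) \int[psi]_x (g' i x)%:E)%E.
  apply: (IH (ltnW nN) g').
  - by move=> i; rewrite /g'; case: ifP => // _; apply: measurable_indic.
  - by move=> i x; rewrite /g'; case: ifP.
  - move=> i; rewrite /g'; case: ifP => // _.
    by rewrite integral_indic// setIT (le_lt_trans (probability_le1 _ mA))// ltry.
  - move=> i ni; rewrite /g'; case: eqP => [_|/eqP nei]; first by exists A.
    by apply: gA; rewrite ltn_neqAle eq_sym nei.
rewrite [in RHS](bigD1 (Ordinal nN))//= {2}/g' eqxx integral_indic// setIT.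
rewrite muleC; under [X in (X * _)%E]eq_bigr => i ni.
  have -> : g' i = g i by rewrite /g' -[n]/(val (Ordinal nN)) val_eqE (negbTE ni).
  over.
rewrite Cfin => <-.
- apply: eq_integral => w _; congr EFin.
  rewrite (bigD1 (Ordinal nN))//= {1}/g' eqxx mulrC; congr (_ * _).
  apply: eq_bigr => i ni.
  by rewrite /g' -[n]/(val (Ordinal nN)) val_eqE (negbTE ni).
Qed.
End products.

(** * Integrals of real functions against a probability *)

Section real_integrals.
Context d (T : measurableType d) (R : realType) (mu : probability T R).
Implicit Types f g : T -> R.

Lemma ge0_fin_integrable f : measurable_fun setT f -> (forall x, 0 <= f x) ->
  (\int[mu]_x (f x)%:E < +oo)%E -> mu.-integrable setT (EFin \o f).
Proof.
move=> mf f0 foo; apply/integrableP; split; first exact/measurable_EFinP.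
by under eq_integral do rewrite /= ger0_norm//.
Qed.

Lemma ge0_integral_EFin_le f g : measurable_fun setT f -> measurable_fun setT g ->
  (forall x, 0 <= f x) -> (forall x, f x <= g x) ->
  (\int[mu]_x (f x)%:E <= \int[mu]_x (g x)%:E)%E.
Proof.
move=> mf mg f0 fg; apply: ge0_le_integral; first by [].
- by move=> x _; rewrite lee_fin.
- exact/measurable_EFinP.
- exact/measurable_EFinP.
- by move=> x _; rewrite lee_fin.
Qed.

Lemma ge0_integral_EFin_ae_le f g :
  measurable_fun setT f -> measurable_fun setT g ->
  (forall x, 0 <= f x) -> (forall x, 0 <= g x) -> {ae mu, forall x, f x <= g x} ->
  (\int[mu]_x (f x)%:E <= \int[mu]_x (g x)%:E)%E.
Proof.
move=> mf mg f0 g0 fg; apply: ae_ge0_le_integral; first by [].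
- by move=> x _; rewrite lee_fin.
- exact/measurable_EFinP.
- by move=> x _; rewrite lee_fin.
- exact/measurable_EFinP.
- by apply: filterS fg => x fg _; rewrite lee_fin.
Qed.

Lemma ge0_integral_EFinZ (k : R) f : 0 <= k -> measurable_fun setT f ->
  (forall x, 0 <= f x) ->
  (\int[mu]_x (k * f x)%:E = k%:E * \int[mu]_x (f x)%:E)%E.
Proof.
move=> k0 mf f0; under eq_integral do rewrite EFinM.
rewrite ge0_integralZl_EFin//; first by move=> x _; rewrite lee_fin.
exact/measurable_EFinP.
Qed.

Lemma ge0_integral_EFinD f g : measurable_fun setT f -> measurable_fun setT g ->
  (forall x, 0 <= f x) -> (forall x, 0 <= g x) ->
  (\int[mu]_x (f x + g x)%:E =
   \int[mu]_x (f x)%:E + \int[mu]_x (g x)%:E)%E.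
Proof.
move=> mf mg f0 g0; under eq_integral do rewrite EFinD.
rewrite ge0_integralD//.
- by move=> x _; rewrite lee_fin.
- exact/measurable_EFinP.
- by move=> x _; rewrite lee_fin.
- exact/measurable_EFinP.
Qed.

Lemma integral_EFin_gt0 f : measurable_fun setT f -> (forall x, 0 <= f x) ->
  {ae mu, forall x, 0 < f x} -> (0 < \int[mu]_x (f x)%:E)%E.
Proof.
move=> mf f0 fpos; rewrite lt0e integral_ge0 ?andbT; last first.
  by move=> x _; rewrite lee_fin.
apply/eqP => int0.
have [/(_ _)/wrap[|H _]] := @ae_eq_integral_abs _ _ _ mu setT measurableT
  (EFin \o f) (proj2 (measurable_EFinP _ _) mf).
  by under eq_integral do rewrite /= ger0_norm//.
have : {ae mu, forall x : T, False}.
  apply: filterS2 fpos H => x fx /(_ I)/= [fx0].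
  by move: fx; rewrite fx0 ltxx.
move=> [N [mN muN0 NT]].
have := @probability_setT _ _ _ mu.
have -> : [set: T] = N by apply/seteqP; split => // x _; apply: NT.
rewrite muN0 => /eqP; rewrite eqe eq_sym oner_eq0 //.
Qed.

Lemma integrable_lin f g (a b : R) :
  mu.-integrable setT (EFin \o f) -> mu.-integrable setT (EFin \o g) ->
  mu.-integrable setT (EFin \o (fun x => a * f x + b * g x)) /\
  \int[mu]_x (a * f x + b * g x) = a * \int[mu]_x f x + b * \int[mu]_x g x.
Proof.
move=> fi gi.
have afi := @integrableZl _ _ _ mu setT measurableT a _ fi.
have bgi := @integrableZl _ _ _ mu setT measurableT b _ gi.
split; first exact: (integrableD measurableT afi bgi).
by rewrite (RintegralD measurableT afi bgi) !RintegralZl.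
Qed.

Lemma Rintegral_cst1 : \int[mu]_x (1 : R) = 1.
Proof.
have e : fine (mu setT) = 1 by rewrite probability_setT.
by rewrite Rintegral_cst// mul1r; exact: e.
Qed.

Lemma integrable1 : mu.-integrable setT (EFin \o (fun=> 1 : R)).
Proof. exact: finite_measure_integrable_cst. Qed.

Lemma EFin_Rintegral f : mu.-integrable setT (EFin \o f) ->
  (\int[mu]_x (f x)%:E)%E = (\int[mu]_x f x)%:E.
Proof.
by move=> fi; rewrite /Rintegral fineK//; exact: (integrable_fin_num measurableT fi).
Qed.

End real_integrals.

(** Both exponentials lie above the tangent at the barycentre. *)
Lemma expR_convex (R : realType) (l a b : R) : 0 <= l <= 1 ->
  expR (l * a + (1 - l) * b) <= l * expR a + (1 - l) * expR b.
Proof.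
move=> /andP[l0 l1]; set c := l * a + _.
have H u : expR c * (1 + (u - c)) <= expR u.
  have -> : expR u = expR c * expR (u - c) by rewrite -expRD; congr expR; ring.
  by rewrite ler_wpM2l// ?expR_ge0// expR_ge1Dx.
have Ha := ler_wpM2l l0 (H a).
have Hb := ler_wpM2l (_ : 0 <= 1 - l) (H b).
rewrite subr_ge0 in Hb.
apply: le_trans (lerD Ha (Hb l1)).
rewrite le_eqVlt; apply/orP; left; apply/eqP.
by rewrite /c; ring.
Qed.

(** * The joint moment generating function *)

Section law.
Context (R : realType) (psi : probability (R * R)%type R).
Implicit Types x y c l r : R.

Definition mgf x y : \bar R := (\int[psi]_z (expR (x * z.1 + y * z.2))%:E)%E.

Lemma measurable_lin x y :
  measurable_fun setT (fun z : R * R => x * z.1 + y * z.2).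
Proof.
by apply: measurable_funD; apply: measurable_funM => //; exact: measurable_cst.
Qed.

Lemma measurable_explin x y :
  measurable_fun setT (fun z : R * R => expR (x * z.1 + y * z.2)).
Proof. by apply: measurableT_comp => //; exact: measurable_lin. Qed.

Lemma expectationE (f : R * R -> R) : ('E_psi[f] = \int[psi]_z (f z)%:E)%E.
Proof. by rewrite unlock. Qed.

Lemma LambdaE x y : Lambda psi x y = lne (mgf x y).
Proof. by rewrite /Lambda expectationE. Qed.

Lemma mgf_ge0 x y : (0 <= mgf x y)%E.
Proof. by apply: integral_ge0 => z _; rewrite lee_fin expR_ge0. Qed.

Lemma mgf00 : mgf 0 0 = 1%E.
Proof.
rewrite /mgf; under eq_integral do rewrite !mul0r addr0 expR0.
by rewrite integral_cst// mul1e; exact: (probability_setT psi).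
Qed.

(** Convexity of the log-moment generating function, stated on its epigraph so
    that no logarithm of a possibly infinite quantity is needed. After
    normalisation by exp (- a) and exp (- a') it is the convexity of exp under
    the integral sign. *)
Lemma mgf_epi_convex l x y a x' y' a' : 0 <= l <= 1 ->
  (mgf x y <= (expR a)%:E)%E -> (mgf x' y' <= (expR a')%:E)%E ->
  (mgf (l * x + (1 - l) * x') (l * y + (1 - l) * y') <=
   (expR (l * a + (1 - l) * a'))%:E)%E.
Proof.
move=> /[dup] l01 /andP[l0 l1] H H'.
have m1 := measurable_explin x y.
have m2 := measurable_explin x' y'.
pose f (z : R * R) := l * (expR (- a) * expR (x * z.1 + y * z.2)) +
  (1 - l) * (expR (- a') * expR (x' * z.1 + y' * z.2)).
have Ef : ((\int[psi]_z (f z)%:E) <= 1)%E.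
  rewrite /f ge0_integral_EFinD; last 4 first.
  - by do 2 apply: measurable_funM => //.
  - by do 2 apply: measurable_funM => //.
  - by move=> z; rewrite !mulr_ge0// ?expR_ge0.
  - by move=> z; rewrite !mulr_ge0// ?expR_ge0// subr_ge0.
  under eq_integral do rewrite mulrA.
  under [X in (_ + X)%E]eq_integral do rewrite mulrA.
  have la0 : 0 <= l * expR (- a) by rewrite mulr_ge0.
  have la0' : 0 <= (1 - l) * expR (- a') by rewrite mulr_ge0// subr_ge0.
  rewrite !ge0_integral_EFinZ//.
  have scale k b u v : 0 <= k -> (mgf u v <= (expR b)%:E)%E ->
      ((k * expR (- b))%:E * mgf u v <= k%:E)%E.
    move=> k0 Hb; apply: (@le_trans _ _ ((k * expR (- b))%:E * (expR b)%:E)%E).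
      by apply: lee_wpmul2l => //; rewrite lee_fin mulr_ge0.
    by rewrite -EFinM -mulrA -expRD addNr expR0 mulr1.
  have H1 := scale _ _ _ _ l0 H.
  have H2 := scale (1 - l) _ _ _ (_ : 0 <= 1 - l) H'; rewrite subr_ge0 in H2.
  refine (le_trans (leeD H1 (H2 l1)) _).
  by rewrite -EFinD addrC subrK.
have mf : measurable_fun setT f.
  by apply: measurable_funD; do 2 apply: measurable_funM => //; exact: measurable_cst.
set b := l * a + _.
apply: (@le_trans _ _ ((expR b)%:E * (\int[psi]_z (f z)%:E))%E); last first.
  by rewrite -[leRHS]mule1 lee_wpmul2l// lee_fin expR_ge0.
rewrite -ge0_integral_EFinZ//; last first.
  by move=> z; rewrite addr_ge0// !mulr_ge0// ?expR_ge0 ?subr_ge0.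
apply: ge0_integral_EFin_le.
- exact: measurable_explin.
- by apply: measurable_funM => //; exact: measurable_cst.
- by move=> z; exact: expR_ge0.
move=> z.
have := expR_convex (x * z.1 + y * z.2 - a) (x' * z.1 + y' * z.2 - a') l01.
rewrite ![expR (_ + _ - _)]expRD ![expR (_ + _) * expR (- _)]mulrC -/(f z).
rewrite -(ler_pM2l (expR_gt0 b)) -[X in X <= _]expRD.
apply: le_trans; rewrite ler_expR /b; lra.
Qed.

(** The exponent c x tau is the convex combination, with weights c and 1 - c, of
    x tau + y W and of - c y W / (1 - c), hence at most their maximum. This is
    what makes moments of tau alone available from joint ones. *)
Lemma mgf_young c eta x y : 0 <= c < 1 -> c * `|y| <= (1 - c) * eta ->
  (mgf x y < +oo)%E -> (\int[psi]_z (expR (eta * `|z.2|))%:E < +oo)%E ->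
  (mgf (c * x) 0 < +oo)%E.
Proof.
move=> /andP[c0 c1] cy Hxy Heta.
have m1 := measurable_explin x y.
have m2 : measurable_fun setT (fun z : R * R => expR (eta * `|z.2|)).
  apply: measurableT_comp => //; apply: measurable_funM => //.
  by apply: measurableT_comp => //.
have : (\int[psi]_z (expR (x * z.1 + y * z.2) + expR (eta * `|z.2|))%:E < +oo)%E.
  rewrite ge0_integral_EFinD//.
  by apply: lte_add_pinfty.
apply: le_lt_trans; apply: ge0_integral_EFin_le.
- exact: measurable_explin.
- exact: measurable_funD.
- by move=> z; exact: expR_ge0.
move=> z; set u := x * _ + _.
have cyz : - (c * y * z.2) <= (1 - c) * eta * `|z.2|.
  apply: le_trans (ler_norm _) _; rewrite normrN !normrM (ger0_norm c0).
  by rewrite ler_wpM2r.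
have [ue|/ltW ue] := leP u (eta * `|z.2|).
  apply: (@le_trans _ _ (expR (eta * `|z.2|))); last by rewrite lerDr expR_ge0.
  by rewrite ler_expR /u in ue *; nra.
apply: (@le_trans _ _ (expR u)); last by rewrite lerDl expR_ge0.
rewrite ler_expR /u in ue *; nra.
Qed.

End law.

(** * Moments of the law *)

Section law_moments.
Context (R : realType) (psi : probability (R * R)%type R).
Implicit Types x y c l r : R.
Local Notation mgf := (mgf psi).
Hypothesis psi_pos : psi (`]0, +oo[ `*` [set: R]) = 1%E.

Lemma ae_tau_gt0 : {ae psi, forall z, 0 < z.1}.
Proof.
exists (~` (`]0, +oo[ `*` [set: R])); split.
- by apply: measurableC; exact: measurableX.
- rewrite probability_setC; last exact: measurableX.
  by rewrite [X in (1 - X)%E]psi_pos subee.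
- by move=> z /= nz; move=> [+ _]; rewrite /= in_itv/= andbT.
Qed.

Lemma measurable_exp_abs (a b : R) : measurable_fun setT
  (fun z : R * R => expR (a * `|z.1| + b * `|z.2|)).
Proof.
apply: measurableT_comp => //.
by apply: measurable_funD; apply: measurable_funM => //; apply: measurableT_comp.
Qed.

Hypothesis theta0_gt0 : (0 < theta0 psi)%E.
Hypothesis eta0_gt0 : (0 < eta0 psi)%E.

Lemma lt_theta0_mgf x : (x%:E < theta0 psi)%E -> (mgf x 0 < +oo)%E.
Proof.
move=> /ereal_sup_gt[_ [t [t0 Et] <-]]; rewrite lte_fin => xt.
rewrite expectationE in Et.
apply: le_lt_trans Et; apply: ge0_integral_EFin_ae_le.
- exact: measurable_explin.
- apply: measurableT_comp => //; exact: measurable_funM.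
- by move=> z; exact: expR_ge0.
- by move=> z; exact: expR_ge0.
apply: filterS ae_tau_gt0 => z z0; rewrite mul0r addr0 ler_expR.
by rewrite ler_pM2r// ltW.
Qed.

Lemma mgf_lty_le_theta0 x : (mgf x 0 < +oo)%E -> (x%:E <= theta0 psi)%E.
Proof.
move=> mx; have [x0|x0] := leP 0 x; last first.
  by apply: ltW; apply: lt_le_trans (ltW theta0_gt0); rewrite lte_fin.
apply: ereal_sup_ubound; exists x => //; split => //.
rewrite expectationE; move: mx; rewrite /mgf.
by under eq_integral do rewrite mul0r addr0.
Qed.

Lemma lt_eta0_exp_moment c : (c%:E < eta0 psi)%E ->
  (\int[psi]_z (expR (c * `|z.2|))%:E < +oo)%E.
Proof.
move=> /ereal_sup_gt[_ [t [t0 Et] <-]]; rewrite lte_fin => xt.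
rewrite expectationE in Et.
have H a : measurable_fun setT (fun z : R * R => expR (a * `|z.2|)).
  apply: measurableT_comp => //; apply: measurable_funM => //.
  exact: measurableT_comp.
apply: le_lt_trans Et; apply: ge0_integral_EFin_le => //.
by move=> z; rewrite ler_expR ler_wpM2r// ltW.
Qed.

(** The variables tau and W may be dependent; the sum |tau| + |W| is at most twice
    the larger of the two, which reduces the claim to the marginals. *)
Lemma exp_moment : exists2 s : R, 0 < s &
  (\int[psi]_z (expR (s * `|z.1| + s * `|z.2|))%:E < +oo)%E.
Proof.
have [t [t0 tth]] : exists t, 0 < t /\ (t%:E < theta0 psi)%E.
  have /ereal_sup_gt[_ [u [u0 Eu] <-]] := theta0_gt0; rewrite lte_fin => u0'.
  exists (u / 2); split; first by rewrite divr_gt0.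
  apply: (@lt_le_trans _ _ u%:E); first by rewrite lte_fin ltr_pdivrMr//; lra.
  by apply: ereal_sup_ubound; exists u.
have [e [e0 ee]] : exists t, 0 < t /\ (t%:E < eta0 psi)%E.
  have /ereal_sup_gt[_ [u [u0 Eu] <-]] := eta0_gt0; rewrite lte_fin => u0'.
  exists (u / 2); split; first by rewrite divr_gt0.
  apply: (@lt_le_trans _ _ u%:E); first by rewrite lte_fin ltr_pdivrMr//; lra.
  by apply: ereal_sup_ubound; exists u.
pose s := Num.min t e / 2.
have s0 : 0 < s by rewrite divr_gt0// lt_min t0.
have st : s * 2 <= t by rewrite /s divfK// ge_min lexx.
have se : s * 2 <= e by rewrite /s divfK// ge_min lexx orbT.
exists s => //.
have mt := lt_theta0_mgf tth; have me := lt_eta0_exp_moment ee.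
have H a : measurable_fun setT (fun z : R * R => expR (a * `|z.2|)).
  apply: measurableT_comp => //; apply: measurable_funM => //.
  exact: measurableT_comp.
have : (\int[psi]_z (expR (t * z.1 + 0 * z.2) + expR (e * `|z.2|))%:E < +oo)%E.
  rewrite ge0_integral_EFinD//; first exact: lte_add_pinfty.
  exact: measurable_explin.
apply: le_lt_trans; apply: ge0_integral_EFin_ae_le.
- exact: measurable_exp_abs.
- by apply: measurable_funD => //; exact: measurable_explin.
- by move=> z; exact: expR_ge0.
- by move=> z; rewrite addr_ge0// expR_ge0.
apply: filterS ae_tau_gt0 => z z0; rewrite gtr0_norm// mul0r addr0.
have h := normr_ge0 z.2.
have [ue|ue] := leP z.1 `|z.2|.
  apply: (@le_trans _ _ (expR (e * `|z.2|))); last by rewrite lerDr expR_ge0.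
  by rewrite ler_expR; nra.
apply: (@le_trans _ _ (expR (t * z.1))); last by rewrite lerDl expR_ge0.
by rewrite ler_expR; nra.
Qed.

Lemma integrable_tau_W : psi.-integrable setT (EFin \o fst) /\
  psi.-integrable setT (EFin \o snd).
Proof.
have [s s0 Es] := exp_moment.
have Hi := ge0_fin_integrable (measurable_exp_abs s s) (fun=> expR_ge0 _) Es.
have Hi' := @integrableZl _ _ _ psi setT measurableT s^-1 _ Hi.
have bnd (a b : R) : `|a| <= s^-1 * expR (s * `|a| + s * `|b|).
  rewrite ler_pdivlMl//; apply: le_trans (expR_ge1Dx _).
  by have := normr_ge0 b; have := mulr_ge0 (ltW s0) (normr_ge0 b); lra.
split; apply: le_integrable Hi' => //.
- exact/measurable_EFinP.
- move=> z _; rewrite /= lee_fin [leRHS]ger0_norm ?bnd//.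
  by rewrite mulr_ge0// ?invr_ge0 ?ltW// expR_ge0.
- exact/measurable_EFinP.
- move=> z _; rewrite /= lee_fin [leRHS]ger0_norm; last first.
    by rewrite mulr_ge0// ?invr_ge0 ?ltW// expR_ge0.
  by rewrite addrC bnd.
Qed.

Definition mean_tau : R := \int[psi]_z z.1.
Definition mean_W : R := \int[psi]_z z.2.

Lemma mean_tau_gt0 : 0 < mean_tau.
Proof.
have [it _] := integrable_tau_W.
rewrite -lte_fin -EFin_Rintegral//.
rewrite (@ae_eq_integral _ _ _ psi setT (fun z => `|z.1|%:E))//; last 3 first.
- exact/measurable_EFinP.
- apply/measurable_EFinP; exact: measurableT_comp.
- by apply: filterS ae_tau_gt0 => z z0 _; rewrite gtr0_norm.
apply: integral_EFin_gt0; [exact: measurableT_comp|by []|].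
by apply: filterS ae_tau_gt0 => z z0; rewrite normr_gt0 gt_eqF.
Qed.

(** The exponential is above its tangent at the mean exponent. In particular the
    moment generating function never vanishes, so that its logarithm is never
    minus infinity. *)
Lemma jensen_mgf x y : ((expR (x * mean_tau + y * mean_W))%:E <= mgf x y)%E.
Proof.
have [it iW] := integrable_tau_W.
have [mxy|] := ltP (mgf x y) +oo%E; last by rewrite leye_eq => /eqP ->; rewrite leey.
have mI := ge0_fin_integrable (measurable_explin x y) (fun=> expR_ge0 _) mxy.
rewrite /mgf EFin_Rintegral// lee_fin.
have [lI lE] := integrable_lin x y it iW.
pose m := x * mean_tau + y * mean_W.
have [lI2 lE2] := integrable_lin (expR m) (expR m * (1 - m)) lI (integrable1 psi).
rewrite lE Rintegral_cst1 in lE2.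
have -> : expR m = expR m * m + expR m * (1 - m) * 1 by ring.
rewrite -/mean_tau -/mean_W -/m in lE2; rewrite -lE2.
apply: le_Rintegral => // z _; rewrite mulr1.
have := expR_ge1Dx (x * z.1 + y * z.2 - m).
rewrite -(ler_pM2l (expR_gt0 m)) -expRD (addrC m) subrK.
by apply: le_trans; rewrite le_eqVlt; apply/orP; left; apply/eqP; ring.
Qed.

Lemma mgf_epi_mean x y l : (mgf x y <= (expR l)%:E)%E ->
  x * mean_tau + y * mean_W <= l.
Proof. by move=> /(le_trans (jensen_mgf x y)); rewrite lee_fin ler_expR. Qed.

Lemma mgf_gt0 x y : (0 < mgf x y)%E.
Proof. by apply: lt_le_trans (jensen_mgf x y); rewrite lte_fin expR_gt0. Qed.

(** The point (-1, 0) lies strictly inside the level set mgf <= 1, because tau is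
    positive: it plays the part of a Slater point, and it also makes the
    renewal times go to infinity exponentially fast. *)
Lemma mgfN1_lt1 : exists2 l, l < 0 & mgf (- 1) 0 = (expR l)%:E.
Proof.
have mf : measurable_fun setT (fun z : R * R => expR (- `|z.1|)).
  by apply: measurableT_comp => //; apply: measurableT_comp => //; apply: measurableT_comp.
have e1 z : expR (- `|z|) <= (1 : R).
  by rewrite -expR0 ler_expR oppr_le0.
have E : mgf (- 1) 0 = (\int[psi]_z (expR (- `|z.1|))%:E)%E.
  apply: ae_eq_integral => //.
  - apply/measurable_EFinP; exact: measurable_explin.
  - exact/measurable_EFinP.
  by apply: filterS ae_tau_gt0 => z z0 _; rewrite gtr0_norm// mulN1r mul0r addr0.
have iN : psi.-integrable setT (EFin \o (fun z : R * R => expR (- `|z.1|))).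
  apply: le_integrable (integrable1 psi) => //; first exact/measurable_EFinP.
  by move=> z _; rewrite /= normr1 ger0_norm ?expR_ge0// lee_fin.
have : (0 < \int[psi]_z (1 - expR (- `|z.1|))%:E)%E.
  apply: integral_EFin_gt0.
  - by apply: measurable_funB.
  - by move=> z; rewrite subr_ge0.
  apply: filterS ae_tau_gt0 => z z0.
  by rewrite subr_gt0 -expR0 ltr_expR oppr_lt0 normr_gt0 gt_eqF.
under eq_integral do rewrite EFinB.
rewrite (integralB_EFin measurableT (integrable1 psi) iN).
rewrite EFin_Rintegral ?integrable1// Rintegral_cst1 EFin_Rintegral//.
rewrite -EFinD lte_fin subr_gt0 => lt1.
have p0 : 0 < \int[psi]_z expR (- `|z.1|).
  by rewrite -lte_fin -EFin_Rintegral// -E mgf_gt0.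
exists (ln (\int[psi]_z expR (- `|z.1|))).
  by rewrite ln_lt0// p0.
by rewrite E EFin_Rintegral// lnK// posrE.
Qed.

End law_moments.

(** * The level-set form of the rate function *)

(** Strong duality for one constraint, for a convex set G of pairs
    (objective, constraint). The multiplier is the supremum of 0
    and of the slopes (f - r) / a over the points with a > 0; a convex combination of such a point
    with a point where a < 0 meets the constraint with equality, which bounds
    these slopes by those on the other side. *)
Lemma lagrange_multiplier (R : realType) (G : R -> R -> Prop) (r : R) :
  (forall l f a f' a', 0 <= l <= 1 -> G f a -> G f' a' ->
     G (l * f + (1 - l) * f') (l * a + (1 - l) * a')) ->
  (exists f a, a < 0 /\ G f a) ->
  (forall f a, G f a -> a <= 0 -> f <= r) ->
  exists2 beta, 0 <= beta & forall f a, G f a -> f <= r + beta * a.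
Proof.
move=> Gconv [f0 [a0 [a00 Gf0]]] Gr.
pose S := [set s : R | s = 0 \/ exists f a, [/\ G f a, 0 < a & s = (f - r) / a]].
have Sub f a : G f a -> a < 0 -> ubound S ((r - f) / - a).
  move=> Gfa an _ [->|[f' [a' [Gfa' a'0 ->]]]].
    apply: divr_ge0; last by rewrite oppr_ge0 ltW.
    by rewrite subr_ge0; apply: Gr Gfa _; exact: ltW.
  rewrite ler_pdivrMr// mulrAC ler_pdivlMr ?oppr_gt0//.
  (* this weight cancels the constraint: t a' + (1 - t) a = 0 *)
  pose t := - a / (a' - a).
  have aa : 0 < a' - a by lra.
  have t01 : 0 <= t <= 1.
    by rewrite /t divr_ge0 ?ler_pdivrMr//; lra.
  have := Gr _ _ (Gconv t _ _ _ _ t01 Gfa' Gfa).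
  have t1 : 1 - t = a' / (a' - a).
    by rewrite /t; field; rewrite gt_eqF.
  rewrite t1 /t.
  have -> : - a / (a' - a) * a' + a' / (a' - a) * a = 0.
    by field; rewrite gt_eqF.
  move=> /(_ (lexx _)).
  have -> : - a / (a' - a) * f' + a' / (a' - a) * f = (- a * f' + a' * f) / (a' - a).
    by field; rewrite gt_eqF.
  rewrite ler_pdivrMr//; lra.
have S0 : S !=set0 by exists 0; left.
have hS : has_sup S by split => //; exists ((r - f0) / - a0); exact: Sub.
exists (sup S); first by apply: ub_le_sup; [exact: hS.2|left].
move=> f a Gfa; have [an|ap|az] := ltgtP a 0.
- have : sup S <= (r - f) / - a by apply: ge_sup => //; exact: Sub.
  by rewrite ler_pdivlMr ?oppr_gt0//; lra.
- have : (f - r) / a <= sup S.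
    by apply: ub_le_sup; [exact: hS.2|right; exists f, a].
  by rewrite ler_pdivrMr//; lra.
- by rewrite az mulr0 addr0; apply: (Gr _ _ Gfa); rewrite az.
Qed.

Section cost.
Context (R : realType) (psi : probability (R * R)%type R).
Implicit Types x y c l r : R.
Local Notation mgf := (mgf psi).

(** The support function, in the direction (1, z), of the convex level set
    where the log-moment generating function is nonpositive. It is J up to
    regularisation. *)
Definition cost (z : R) : \bar R :=
  ereal_sup [set (u.1 + z * u.2)%:E | u in [set u : R * R | (mgf u.1 u.2 <= 1)%E]].

Lemma cost_ge x y z : (mgf x y <= 1)%E -> ((x + z * y)%:E <= cost z)%E.
Proof. by move=> H; apply: ereal_sup_ubound; exists (x, y). Qed.

Lemma lt_cost c z : (c%:E < cost z)%E ->
  exists x y, (mgf x y <= 1)%E /\ c < x + z * y.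
Proof.
by move=> /ereal_sup_gt[_ [[x y] /= xy <-]]; rewrite lte_fin => ?; exists x, y.
Qed.

Lemma cost_ge0 z : (0 <= cost z)%E.
Proof.
have := @cost_ge 0 0 z; rewrite mulr0 addr0; apply.
by rewrite mgf00.
Qed.

Lemma le_cost_J z : (cost z <= J psi z)%E.
Proof.
apply: le_ereal_inf_tmp => _ [b /= b0 <-].
apply: ge_ereal_sup => _ [[x y] /= xy <-].
rewrite -(@lee_pdivrMl _ b)//.
apply: (@le_trans _ _ ((1 / b * x + z / b * y)%:E - Lambda psi x y)%E); last first.
  by apply: ereal_sup_ubound; exists (x, y).
apply: (@le_trans _ _ ((1 / b * x + z / b * y)%:E - 0)%E).
  by rewrite sube0 -EFinM lee_fin le_eqVlt; apply/orP; left; apply/eqP; field; rewrite gt_eqF.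
rewrite leeD2l// leeN2 LambdaE -lne1.
by rewrite lee_lne ?in_itv/= ?leey ?mgf_ge0 ?lee01//.
Qed.

Hypothesis psi_pos : psi (`]0, +oo[ `*` [set: R]) = 1%E.
Hypothesis theta0_gt0 : (0 < theta0 psi)%E.
Hypothesis eta0_gt0 : (0 < eta0 psi)%E.

Lemma J_le_affine b r z : 0 < b ->
  (forall x y l, (mgf x y <= (expR l)%:E)%E -> x + z * y <= r + b * l) ->
  (J psi z <= r%:E)%E.
Proof.
move=> b0 H.
apply: (@le_trans _ _ (b%:E * Lambda_star psi (1 / b) (z / b))%E).
  by apply: ereal_inf_lbound; exists b.
rewrite -lee_pdivlMl//; apply: ge_ereal_sup => _ [[x y] /= _ <-].
rewrite LambdaE; have m0 := mgf_gt0 psi_pos theta0_gt0 eta0_gt0 x y.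
case E : (mgf x y) m0 => [e| |] //; last by rewrite addeNy leNye.
rewrite lte_fin => e0; rewrite lne_EFin// -EFinM -EFinB lee_fin.
have := H x y (ln e); rewrite E lnK ?posrE// => /(_ (lexx _)) h.
rewrite ler_pdivlMl//.
have -> : b * (1 / b * x + z / b * y - ln e) = x + z * y - b * ln e.
  by field; rewrite gt_eqF.
lra.
Qed.

Lemma cost_multiplier z r : (cost z <= r%:E)%E ->
  exists2 b, 0 <= b &
    forall x y l, (mgf x y <= (expR l)%:E)%E -> x + z * y <= r + b * l.
Proof.
move=> zr.
pose G f l := exists x y, (mgf x y <= (expR l)%:E)%E /\ f = x + z * y.
have [|||b b0 H] := @lagrange_multiplier R G r.
- move=> l f a f' a' l01 [x [y [H ->]]] [x' [y' [H' ->]]].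
  exists (l * x + (1 - l) * x'), (l * y + (1 - l) * y'); split.
    exact: mgf_epi_convex.
  by ring.
- have [l l0 E] := mgfN1_lt1 psi_pos theta0_gt0 eta0_gt0.
  by exists (-1 + z * 0), l; split => //; exists (-1), 0; rewrite E.
- move=> f a [x [y [H ->]]] a0; rewrite -lee_fin; apply: le_trans zr.
  by apply: cost_ge; apply: le_trans H _; rewrite -expR0 lee_fin ler_expR.
by exists b => // x y l H'; apply: H; exists x, y.
Qed.

Local Notation m := (mean_W psi / mean_tau psi).

Lemma mgf_le1_mean x y : (mgf x y <= 1)%E -> x + m * y <= 0.
Proof.
rewrite -expR0 => /(mgf_epi_mean psi_pos theta0_gt0 eta0_gt0).
have t0 := mean_tau_gt0 psi_pos theta0_gt0 eta0_gt0.
have -> : x + m * y = (x * mean_tau psi + y * mean_W psi) / mean_tau psi.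
  by field; rewrite gt_eqF.
by rewrite ler_pdivrMr// mul0r.
Qed.

End cost.

(** * Comparison of the cost with J and its regularisation *)

Section cost_J.
Context (R : realType) (psi : probability (R * R)%type R).
Implicit Types x y c l r : R.
Local Notation mgf := (mgf psi).
Hypothesis psi_pos : psi (`]0, +oo[ `*` [set: R]) = 1%E.
Hypothesis theta0_gt0 : (0 < theta0 psi)%E.
Hypothesis eta0_gt0 : (0 < eta0 psi)%E.
Local Notation m := (mean_W psi / mean_tau psi).

Lemma mgf_lty_log x y : (mgf x y < +oo)%E -> exists l, mgf x y = (expR l)%:E.
Proof.
have := mgf_gt0 psi_pos theta0_gt0 eta0_gt0 x y.
case: (mgf x y) => [e| |]//; rewrite lte_fin => e0 _.
by exists (ln e); rewrite lnK.
Qed.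

Lemma mgf0_lty c y : `|y| <= c ->
  (\int[psi]_z (expR (c * `|z.2|))%:E < +oo)%E -> (mgf 0 y < +oo)%E.
Proof.
move=> yc; apply: le_lt_trans; apply: ge0_integral_EFin_le.
- exact: measurable_explin.
- apply: measurableT_comp => //; apply: measurable_funM => //.
  exact: measurableT_comp.
- by move=> z; exact: expR_ge0.
move=> z; rewrite mul0r add0r ler_expR (le_trans (ler_norm _))// normrM.
by rewrite ler_wpM2r.
Qed.

(** Adding the Jensen inequality x + m y <= Lambda x y / E tau with weight l
    makes the multiplier positive, even if the multiplier at z is 0. *)
Lemma J_segment_le z r l : 0 < l <= 1 -> (cost psi z <= r%:E)%E ->
  (J psi ((1 - l) * z + l * m) <= ((1 - l) * r)%:E)%E.
Proof.
move=> /andP[l0 l1] /(cost_multiplier psi_pos theta0_gt0 eta0_gt0)[b b0 H].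
have t0 := mean_tau_gt0 psi_pos theta0_gt0 eta0_gt0.
apply: (@J_le_affine _ _ psi_pos theta0_gt0 eta0_gt0
          ((1 - l) * b + l / mean_tau psi)).
  by rewrite ltr_wpDl ?divr_gt0// mulr_ge0// subr_ge0.
move=> x y a xya.
have h1 := ler_wpM2l (_ : 0 <= 1 - l) (H _ _ _ xya).
rewrite subr_ge0 in h1; have {}h1 := h1 l1.
have h2 := mgf_epi_mean psi_pos theta0_gt0 eta0_gt0 xya.
have h3 : l * (x + m * y) <= l / mean_tau psi * a.
  have -> : l * (x + m * y) = l / mean_tau psi * (x * mean_tau psi + y * mean_W psi).
    by field; rewrite gt_eqF.
  by rewrite ler_wpM2l// divr_ge0// ltW.
have -> : x + ((1 - l) * z + l * m) * y =
  (1 - l) * (x + z * y) + l * (x + m * y) by ring.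
apply: le_trans (lerD h1 h3) _.
by rewrite le_eqVlt; apply/orP; left; apply/eqP; ring.
Qed.

(** A point (x, y) of the level set has c x below theta0 for every c < 1: all
    exponential moments of W are finite, so Young's inequality applies. *)
Lemma cost0_le_theta0 : eta0 psi = +oo%E -> (cost psi 0 <= theta0 psi)%E.
Proof.
move=> eta_y; apply: ge_ereal_sup => _ [[x y] /= xy <-]; rewrite mul0r addr0.
rewrite leNgt; apply/negP.
case E : (theta0 psi) theta0_gt0 => [t| |]//; rewrite !lte_fin => t0 tx.
have x0 : 0 < x by lra.
(* then c x is the midpoint of t and x *)
pose c := (t + x) / (2 * x).
have c01 : 0 <= c < 1.
  by rewrite /c divr_ge0 ?ltr_pdivrMr//; lra.
have c1 : 0 < 1 - c by case/andP: c01; lra.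
pose eta := c * `|y| / (1 - c).
have eoo : (\int[psi]_z (expR (eta * `|z.2|))%:E < +oo)%E.
  by apply: lt_eta0_exp_moment; rewrite eta_y ltry.
have H : c * `|y| <= (1 - c) * eta.
  suff -> : (1 - c) * eta = c * `|y| by [].
  by rewrite /eta; field; rewrite gt_eqF.
have /mgf_lty_le_theta0 := mgf_young c01 H (le_lt_trans xy (ltry 1)) eoo.
move=> /(_ theta0_gt0); rewrite E lee_fin.
have -> : c * x = (t + x) / 2 by rewrite /c; field; rewrite gt_eqF.
by rewrite ler_pdivrMr//; lra.
Qed.

(** A vanishing multiplier at z bounds x + z y on the whole domain of the moment
    generating function. That domain contains all (0, y), which forces z = 0,
    and all (x, 0) with x < theta0, which gives the second term of the minimum
    at 0. *)
Lemma Jbar_cost z : eta0 psi = +oo%E -> Jbar psi z = cost psi z.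
Proof.
move=> eta_y; apply/eqP; rewrite eq_le; apply/andP; split; last first.
  rewrite /Jbar; case: eqP => [->|_]; last exact: le_cost_J.
  by rewrite le_min le_cost_J cost0_le_theta0.
have := cost_ge0 psi z; case E : (cost psi z) => [r| |] // _; last by rewrite leey.
have zr : (cost psi z <= r%:E)%E by rewrite E.
have [b bge0 H] := cost_multiplier psi_pos theta0_gt0 eta0_gt0 zr.
have [b0|bn0] := ltP 0 b.
  have Jr := J_le_affine psi_pos theta0_gt0 eta0_gt0 b0 H.
  by rewrite /Jbar; case: eqP => [z0|//]; rewrite ge_min -{1}z0 Jr.
have b0 : b = 0 by apply/eqP; rewrite eq_le bn0.
have {}H x y : (mgf x y < +oo)%E -> x + z * y <= r.
  move=> /mgf_lty_log[l El]; have := H x y l; rewrite El lexx b0 mul0r addr0.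
  exact.
rewrite /Jbar; case: eqP => [z0|/eqP z0]; last first.
  have := H 0 ((r + 1) / z).
  have -> : 0 + z * ((r + 1) / z) = r + 1 by field.
  have fin : (mgf 0 ((r + 1) / z) < +oo)%E.
    apply: (mgf0_lty (lexx _)); apply: lt_eta0_exp_moment.
    by rewrite eta_y ltry.
  by move=> /(_ fin); rewrite gerDl ler10.
rewrite ge_min; apply/orP; right.
apply: ge_ereal_sup => _ [t [t0 Et] <-]; rewrite lee_fin.
have := H t 0; rewrite mulr0 addr0; apply.
move: Et; rewrite expectationE /mgf; congr (_ < _)%E.
by apply: eq_integral => u _; rewrite mul0r addr0.
Qed.

Lemma cost_lower_semicontinuous : lower_semicontinuous (cost psi).
Proof.
move=> z a /lt_cost[x [y [xy axy]]].
exists [set z' | a < x + z' * y]; last first.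
  by move=> z' /= h; apply: lt_le_trans (cost_ge z' xy); rewrite lte_fin.
have y1 : 0 < `|y| + 1 by rewrite ltr_wpDl.
apply/nbhs_ballP; exists ((x + z * y - a) / (`|y| + 1)) => /=.
  by rewrite divr_gt0// subr_gt0.
move=> z' /=; rewrite /ball/= => zz'.
have : `|(z - z') * y| <= `|z - z'| * (`|y| + 1).
  by rewrite normrM ler_wpM2l// lerDl.
rewrite ltr_pdivlMr// in zz' => h.
have := ler_norm ((z - z') * y); lra.
Qed.

(** Points of the level set with second coordinate of either sign; they give
    affine minorants of the cost of positive and of negative slope, hence its
    compact level sets. They are found between (-1, 0) and the second axis. *)
Lemma admissible_slope (e : R) : exists k x,
  0 < k /\ (mgf x (k * e) <= 1)%E.
Proof.
have [s s0 Es] := exp_moment psi_pos theta0_gt0 eta0_gt0.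
have [l0 l00 El0] := mgfN1_lt1 psi_pos theta0_gt0 eta0_gt0.
pose u := s / (`|e| + 1).
have e1 : 0 < `|e| + 1 by rewrite ltr_wpDl.
have u0 : 0 < u by rewrite divr_gt0.
have [l El] : exists l, mgf 0 (u * e) = (expR l)%:E.
  apply: mgf_lty_log; apply: (@mgf0_lty s).
    by rewrite normrM gtr0_norm// /u mulrAC ler_pdivrMr// ler_pM2l// lerDl.
  apply: le_lt_trans Es; apply: ge0_integral_EFin_le.
  - apply: measurableT_comp => //; apply: measurable_funM => //.
    exact: measurableT_comp.
  - exact: measurable_exp_abs.
  - by move=> z; exact: expR_ge0.
  by move=> z; rewrite ler_expR lerDr mulr_ge0// ltW.
pose t := - l0 / (- l0 + `|l| + 1).
have l1 : 0 < - l0 + `|l| + 1 by have := normr_ge0 l; lra.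
have t0 : 0 < t by rewrite divr_gt0// oppr_gt0.
have t1 : t <= 1 by rewrite ler_pdivrMr// mul1r; have := normr_ge0 l; lra.
exists (t * u), (t * 0 + (1 - t) * -1); split; first by rewrite mulr_gt0.
have t01 : 0 <= t <= 1 by rewrite ltW.
have := mgf_epi_convex t01 (_ : mgf 0 (u * e) <= (expR l)%:E)%E
  (_ : mgf (-1) 0 <= (expR l0)%:E)%E.
rewrite El El0 !lexx => /(_ isT isT).
rewrite [(1 - t) * 0]mulr0 addr0 mulrA => /le_trans; apply.
rewrite (_ : 1%E = (expR 0)%:E); last by rewrite expR0.
rewrite lee_fin ler_expR.
have h : t * l <= t * `|l| by rewrite ler_pM2l// ler_norm.
apply: (@le_trans _ _ (t * `|l| + (1 - t) * l0)); first by lra.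
rewrite le_eqVlt; apply/orP; right.
have -> : t * `|l| + (1 - t) * l0 = l0 / (- l0 + `|l| + 1).
  by rewrite /t; field; rewrite gt_eqF.
by rewrite ltr_pdivrMr// mul0r.
Qed.

Lemma cost_compact a : compact [set z | (cost psi z <= a%:E)%E].
Proof.
have [k [x [k0 xk]]] := admissible_slope 1.
have [k' [x' [k'0 xk']]] := admissible_slope (-1).
rewrite mulr1 in xk; rewrite mulrN1 in xk'.
apply: (@subclosed_compact _ _ `[(x' - a) / k', (a - x) / k]); first last.
- move=> z /= za.
  have := le_trans (cost_ge z xk) za; have := le_trans (cost_ge z xk') za.
  rewrite !lee_fin in_itv/= ler_pdivrMr// ler_pdivlMr// => h1 h2.
  by apply/andP; split; lra.
- exact: segment_compact.
- rewrite (_ : [set z | _] = ~` [set z | (a%:E < cost psi z)%E]).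
    apply: open_closedC.
    exact: ((lower_semicontinuousP (cost psi)).1 cost_lower_semicontinuous a).
  by apply/seteqP; split => z /=; rewrite leNgt => /negP.
Qed.
End cost_J.

(** * Renewal counts and rewards *)

Lemma sup_nat_has_sup (A : set nat) : has_sup A ->
  A (supremum 0%N A) /\ forall k, A k -> (k <= supremum 0%N A)%N.
Proof.
move=> [[n0 An0] hub]; have [s [sub slb]] := nat_supremums_neq0 hub.
have -> : supremum 0%N A = s.
  rewrite /supremum ifF; last by apply/eqP => A0; rewrite A0 in An0.
  case: xgetP => [y _ Hy|/(_ s) nH]; last by exfalso; apply: nH.
  exact: (is_subset1_supremums Hy).
split; last by move=> k Ak; exact: sub.
apply: contrapT => nAs.
have [s0|s0] := posnP s.
  by apply: nAs; have := sub _ An0; rewrite s0 leEnat leqn0 => /eqP <-.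
have : (s <= s.-1)%O.
  apply: slb => k Ak; have := sub _ Ak; rewrite !leEnat leq_eqVlt => /predU1P[ks|].
    by exfalso; apply: nAs; rewrite -ks.
  by move=> ks; rewrite -ltnS prednK.
by rewrite leEnat -ltnS prednK// ltnn.
Qed.

Section renewal.
Context (R : realType) d (Omega : measurableType d) (P : probability Omega R).
Context (psi : probability (R * R)%type R).
Context (X : nat -> {RV P >-> (R * R)%type}).

Local Notation S := (renewal_time X).
Local Notation M := (renewal_count X).

Definition reward_sum n w : R := \sum_(i < n) (X i w).2.

Definition renewals_bounded t : set Omega := [set w | has_ubound [set n | S n w <= t]].

Lemma renewal_time0 w : S 0 w = 0.
Proof. by rewrite /renewal_time big_ord0. Qed.

Lemma renewal_timeS n w : S n.+1 w = S n w + (X n w).1.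
Proof. by rewrite /renewal_time big_ord_recr. Qed.

Lemma renewal_count_bounded t w : 0 <= t -> renewals_bounded t w ->
  S (M t w) w <= t /\ forall k, (M t w < k)%N -> t < S k w.
Proof.
move=> t0 bw.
have [|H1 H2] := @sup_nat_has_sup [set n | S n w <= t].
  by split => //; exists 0%N => /=; rewrite renewal_time0.
split; first exact: H1.
move=> k; rewrite ltnNge => /negP kM; rewrite ltNge; apply/negP => St.
by apply: kM; exact: H2.
Qed.

Lemma renewal_countSP t n w : M t w = n.+1 <->
  S n.+1 w <= t /\ forall k, (n.+1 < k)%N -> t < S k w.
Proof.
split=> [Mn|[H1 H2]].
  have hs : has_sup [set n | S n w <= t].
    apply: contrapT => nh; move: Mn; rewrite /renewal_count supremum_out//.
  have [H1 H2] := sup_nat_has_sup hs.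
  rewrite -/(M t w) Mn in H1 H2; split => // k nk.
  rewrite ltNge; apply/negP => St; have := H2 _ St.
  by rewrite leqNgt nk.
have hub k : S k w <= t -> (k <= n.+1)%N.
  by move=> Sk; rewrite leqNgt; apply/negP => /H2; rewrite ltNge Sk.
have hs : has_sup [set n | S n w <= t].
  by split; [exists n.+1|exists n.+1 => k; exact: hub].
have [h1 h2] := sup_nat_has_sup hs.
apply/eqP; rewrite eqn_leq; apply/andP; split; first exact: hub.
exact: h2.
Qed.

Lemma measurable_X1 i : measurable_fun setT (fun w => (X i w).1).
Proof. exact: measurableT_comp. Qed.

Lemma measurable_X2 i : measurable_fun setT (fun w => (X i w).2).
Proof. exact: measurableT_comp. Qed.

Lemma measurable_renewal_time n : measurable_fun setT (S n).
Proof. by apply: measurable_sum => i; exact: measurable_X1. Qed.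

Lemma measurable_reward_sum n : measurable_fun setT (reward_sum n).
Proof. by apply: measurable_sum => i; exact: measurable_X2. Qed.

Lemma measurable_le_cst (f : Omega -> R) t : measurable_fun setT f ->
  measurable [set w | f w <= t].
Proof.
move=> mf; rewrite (_ : [set w | _] = f @^-1` `]-oo, t]).
  by rewrite -[_ @^-1` _]setTI; exact: mf.
by apply/seteqP; split => w /=; rewrite in_itv.
Qed.

Lemma measurable_lt_cst (f : Omega -> R) t : measurable_fun setT f ->
  measurable [set w | t < f w].
Proof.
move=> mf; rewrite (_ : [set w | _] = f @^-1` `]t, +oo[).
  by rewrite -[_ @^-1` _]setTI; exact: mf.
by apply/seteqP; split => w /=; rewrite in_itv/= andbT.
Qed.

Lemma measurable_renewal_count t n : measurable [set w | M t w = n].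
Proof.
have mS k : measurable [set w | M t w = k.+1].
  rewrite (_ : [set w | _] = [set w | S k.+1 w <= t] `&`
    \bigcap_j (if (k.+1 < j)%N then [set w | t < S j w] else setT)).
    apply: measurableI; first exact/measurable_le_cst/measurable_renewal_time.
    apply: bigcapT_measurable => j; case: ifP => // _.
    exact/measurable_lt_cst/measurable_renewal_time.
  apply/seteqP; split => [w /= /renewal_countSP[H1 H2]|w /= [H1 H2]].
    by split => // j _; case: ifP => // /H2.
  by apply/renewal_countSP; split => // j kj; have := H2 j I; rewrite kj.
case: n => [|n]; last exact: mS.
rewrite (_ : [set w | _] = ~` \bigcup_k [set w | M t w = k.+1]).
  by apply: measurableC; exact: bigcupT_measurable.
apply/seteqP; split => [w /= H [k _] /= Hk|w /= H]; first by rewrite Hk in H.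
by case E : (M t w) => [//|k]; exfalso; apply: H; exists k.
Qed.

Lemma measurable_reward t : measurable_fun setT (reward X t).
Proof.
move=> _ B mB; rewrite setTI.
rewrite (_ : _ @^-1` B = \bigcup_n ([set w | M t w = n] `&` (reward_sum n @^-1` B))).
  apply: bigcupT_measurable => n; apply: measurableI.
    exact: measurable_renewal_count.
  by rewrite -[_ @^-1` _]setTI; exact: measurable_reward_sum.
apply/seteqP; split => [w /= H|w /= [n _ [/= <-]]]; last by [].
by exists (M t w).
Qed.

Lemma measurable_velocity t : measurable_fun setT (fun w => reward X t w / t).
Proof. by apply: measurable_funM => //; exact: measurable_reward. Qed.

Lemma measurable_affine_ge0 (f : Omega -> R) (y b : R) : measurable_fun setT f ->
  measurable [set w | 0 <= y * (f w - b)].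
Proof.
move=> mf; rewrite (_ : [set w | _] = ~` [set w | 0 < - (y * (f w - b))]).
  apply: measurableC; apply: measurable_lt_cst; apply: measurableT_comp => //.
  by apply: measurable_funM => //; apply: measurable_funB.
by apply/seteqP; split => w /=; rewrite oppr_gt0 leNgt => /negP.
Qed.

Lemma measurable_velocity_near t z e :
  measurable [set w | `|reward X t w / t - z| < e].
Proof.
rewrite (_ : [set w | _] = [set w | 0 < - (`|reward X t w / t - z| - e)]).
  apply: measurable_lt_cst; apply: measurableT_comp => //.
  apply: measurable_funB => //; apply: measurableT_comp => //.
  by apply: measurable_funB => //; exact: measurable_velocity.
by apply/seteqP; split => w /=; rewrite oppr_gt0 subr_lt0.
Qed.

Lemma renewal_time_le w j k : (forall i, 0 < (X i w).1) -> (j <= k)%N ->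
  S j w <= S k w.
Proof.
move=> wpos jk; rewrite -(subnKC jk); elim: (k - j)%N => [|i IH]; first by rewrite addn0.
by rewrite addnS renewal_timeS (le_trans IH)// lerDl ltW.
Qed.

Lemma measurable_renewals_bounded t : measurable (renewals_bounded t).
Proof.
rewrite (_ : renewals_bounded t = \bigcup_n \bigcap_k
   (if (n < k)%N then [set w | t < S k w] else setT)).
  apply: bigcupT_measurable => n; apply: bigcapT_measurable => k.
  by case: ifP => // _; exact/measurable_lt_cst/measurable_renewal_time.
apply/seteqP; split => [w /= [n nub]|w /= [n _ H]].
  exists n => // k _; case: ifP => // nk /=; rewrite ltNge; apply/negP => /nub.
  by rewrite leEnat leqNgt nk.
exists n => k /= Sk; rewrite leEnat leqNgt; apply/negP => nk.
by have := H k I; rewrite nk /= ltNge Sk.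
Qed.

Hypothesis psi_pos : psi (`]0, +oo[ `*` [set: R]) = 1%E.
Hypothesis X_iid : iid_with_law psi X.

Lemma ae_all_tau_gt0 : {ae P, forall w, forall i, 0 < (X i w).1}.
Proof.
apply/ae_foralln => i.
have mA : measurable (`]0, +oo[ `*` [set: R] : set (R * R)) by exact: measurableX.
have mXA : measurable (X i @^-1` (`]0, +oo[ `*` [set: R])).
  by rewrite -[_ @^-1` _]setTI; exact: measurable_funPT.
exists (~` (X i @^-1` (`]0, +oo[ `*` [set: R]))); split.
- exact: measurableC.
- rewrite [LHS](probability_setC P mXA).
  have := X_iid.2 i _ mA; rewrite psi_pos => H.
  by rewrite [X in (1 - X)%E](H : P _ = 1%E) subee.
- by move=> w /= nz; move=> [+ _]; rewrite /= in_itv/= andbT.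
Qed.

Lemma prob_le_integral (A : set Omega) (f : Omega -> R) : measurable A ->
  measurable_fun setT f -> (forall w, 0 <= f w) -> (forall w, A w -> 1 <= f w) ->
  (P A <= \int[P]_w (f w)%:E)%E.
Proof.
move=> mA mf f0 f1.
rewrite -[A]setIT -integral_indic//; apply: ge0_integral_EFin_le => //.
move=> w; rewrite indicE; case: (boolP (w \in A)) => // /set_mem.
exact: f1.
Qed.

End renewal.

(** * The exponential upper bound *)

Lemma geometric_eseries_le (R : realType) (a q : R) : 0 <= a -> 0 <= q < 1 ->
  (\sum_(0 <= n <oo) (a * q ^+ n)%:E <= (a / (1 - q))%:E)%E.
Proof.
move=> a0 /andP[q0 q1]; have q10 : 0 < 1 - q by rewrite subr_gt0.
apply: lime_le; first by apply: is_cvg_nneseries => n _ _; rewrite lee_fin mulr_ge0 ?exprn_ge0.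
apply: nearW => n; rewrite sumEFin lee_fin.
have := geometric_seriesE a (_ : q != 1); rewrite lt_eqF// => /(_ isT).
move=> /(congr1 (fun f => f n)) /=.
rewrite /series/= => ->; rewrite ler_pM2r ?invr_gt0// ler_piMr//.
by rewrite gerBl exprn_ge0.
Qed.

Section upper_bound.
Context (R : realType) d (Omega : measurableType d) (P : probability Omega R).
Context (psi : probability (R * R)%type R).
Context (X : nat -> {RV P >-> (R * R)%type}).
Hypothesis psi_pos : psi (`]0, +oo[ `*` [set: R]) = 1%E.
Hypothesis X_iid : iid_with_law psi X.
Hypothesis theta0_gt0 : (0 < theta0 psi)%E.
Hypothesis eta0_gt0 : (0 < eta0 psi)%E.

Local Notation S := (renewal_time X).
Local Notation M := (renewal_count X).
Local Notation V := (reward_sum X).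
Local Notation mgf := (mgf psi).

Lemma prode_expR_const (l : R) n (f : 'I_n -> \bar R) : (forall i, f i = (expR l)%:E) ->
  (\prod_(i < n) f i = (expR l ^+ n)%:E)%E.
Proof.
by move=> fE; under eq_bigr do rewrite fE; rewrite prodEFin prodr_const card_ord.
Qed.

Lemma prob_renewal_time_le t n l : mgf (-1) 0 = (expR l)%:E ->
  (P [set w | (S n w <= t)%R] <= (expR t * expR l ^+ n)%:E)%E.
Proof.
move=> El.
have -> : ((expR t * expR l ^+ n)%:E =
   \int[P]_w (expR t * \prod_(i < n) expR (- 1 * (X i w).1 + 0 * (X i w).2))%:E)%E.
  rewrite ge0_integral_EFinZ ?expR_ge0//; last 2 first.
  - apply: measurable_prod => i _; apply: measurableT_comp => //.
    apply: measurable_funD; apply: measurable_funM => //; [exact: measurable_X1|exact: measurable_X2].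
  - by move=> w; apply: prodr_ge0 => i _; exact: expR_ge0.
  rewrite (expectation_prod_iid X_iid n (f := fun _ z => expR (-1 * z.1 + 0 * z.2))).
  - by rewrite (prode_expR_const (l := l))// EFinM.
  - by move=> _; exact: measurable_explin.
  - by move=> _ z; exact: expR_ge0.
  - by move=> _; rewrite -/(mgf (-1) 0) El ltry.
apply: prob_le_integral.
- by apply: measurable_le_cst; exact: measurable_renewal_time.
- apply: measurable_funM => //.
  apply: measurable_prod => i _; apply: measurableT_comp => //.
  apply: measurable_funD; apply: measurable_funM => //; [exact: measurable_X1|exact: measurable_X2].
- by move=> w; rewrite mulr_ge0 ?expR_ge0//; apply: prodr_ge0 => i _; exact: expR_ge0.
move=> w /= St; rewrite -expR_sum -expRD -[leLHS]expR0 ler_expR.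
have -> : \sum_(i < n) (-1 * (X i w).1 + 0 * (X i w).2) = - S n w.
  rewrite /renewal_time -sumrN; apply: eq_bigr => i _; ring.
by rewrite subr_ge0.
Qed.

(** Infinitely many renewals before t force S_n <= t for all n, an event of
    probability at most exp t times the n-th power of E exp (- tau). *)
Lemma prob_renewals_unbounded t : P (~` renewals_bounded X t) = 0%E.
Proof.
have [l l0 El] := mgfN1_lt1 psi_pos theta0_gt0 eta0_gt0.
have bd n : (P (~` renewals_bounded X t) <= (expR t * expR l ^+ n)%:E)%E.
  apply: le_trans (prob_renewal_time_le t n El).
  have [N [mN PN0 NP]] := ae_all_tau_gt0 psi_pos X_iid.
  have mB : measurable (~` renewals_bounded X t).
    by apply: measurableC; exact: measurable_renewals_bounded.
  have mS : measurable [set w | S n w <= t].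
    by apply: measurable_le_cst; exact: measurable_renewal_time.
  apply: (@le_trans _ _ (P ([set w | (S n w <= t)%R] `|` N))).
    apply: le_measure; rewrite ?inE//; first exact: measurableU.
    move=> w nb; have [wpos|wneg] := pselect (forall i, 0 < (X i w).1).
      left => /=; rewrite leNgt; apply/negP => tS; apply: nb.
      exists n => k /= Sk; rewrite leEnat leqNgt; apply/negP => nk.
      have := renewal_time_le wpos (ltnW nk).
      by rewrite leNgt (le_lt_trans Sk).
    by right; apply: NP.
  apply: le_trans (measureU2 _ mS mN) _.
  by rewrite [X in (_ + X)%E]PN0 adde0.
apply/eqP; rewrite eq_le measure_ge0 andbT.
apply/lee_addgt0Pr => e e0; rewrite add0e.
have cv : (fun n => expR t * expR l ^+ n) @ \oo --> (0 : R).
  by apply: cvg_geometric; rewrite ger0_norm ?expR_ge0// -expR0 ltr_expR.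
have [n _ Hn] := (@cvgrPdist_lt _ _ _ _ _ _ _).1 cv e e0.
apply: le_trans (bd n) _; rewrite lee_fin.
have := Hn n (leqnn n); rewrite sub0r normrN => /ltW.
by apply: le_trans; exact: ler_norm.
Qed.

(** The factor 1 + exp (x tau) of the last, incomplete, interval dominates both
    1 and exp (x tau), which treats x < 0 (where S_n <= t is used) and x >= 0
    (where t < S_(n+1) is used) at once. The sum over the number n of renewals
    is geometric. *)
Lemma upper_exponential_bound (x y z q c : R) :
  mgf x 0 = c%:E -> mgf x y = q%:E -> q < 1 ->
  exists2 K, 0 <= K & forall t, 0 <= t ->
    (P [set w | (0 <= y * (reward X t w - z * t))%R] <=
       (K * expR (- (x + z * y) * t))%:E)%E.
Proof.
move=> xc xyq q1.
have q0 : 0 <= q by rewrite -lee_fin -xyq mgf_ge0.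
have c0 : 0 <= c by rewrite -lee_fin -xc mgf_ge0.
exists ((1 + c) / (1 - q)); first by apply: divr_ge0; [exact: addr_ge0|rewrite subr_ge0 ltW].
move=> t t0.
pose E := [set w | (0 <= y * (reward X t w - z * t))%R].
have mE : measurable E by apply: measurable_affine_ge0; exact: measurable_reward.
pose A n := [set w | S n w <= t] `&` [set w | t < S n.+1 w] `&`
  [set w | 0 <= y * (V n w - z * t)].
have mA n : measurable (A n).
  apply: measurableI; last by apply: measurable_affine_ge0; exact: measurable_reward_sum.
  apply: measurableI.
    by apply: measurable_le_cst; exact: measurable_renewal_time.
  by apply: measurable_lt_cst; exact: measurable_renewal_time.
have mB : measurable (~` renewals_bounded X t).
  by apply: measurableC; exact: measurable_renewals_bounded.
have EA : E `<=` \bigcup_n A n `|` ~` renewals_bounded X t.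
  move=> w Ew; have [bw|nbw] := pselect (renewals_bounded X t w); last by right.
  left; have [H1 H2] := renewal_count_bounded t0 bw.
  by exists (M t w) => //; split; [split => //; exact: H2|exact: Ew].
have mUA : measurable (\bigcup_n A n) by exact: bigcupT_measurable.
have PE : (P E <= P (\bigcup_n A n))%E.
  apply: (@le_trans _ _ (P (\bigcup_n A n `|` ~` renewals_bounded X t))).
    by apply: le_measure; rewrite ?inE//; exact: measurableU.
  apply: le_trans (measureU2 _ mUA mB) _.
  by rewrite [X in (_ + X)%E](prob_renewals_unbounded t) adde0.
apply: (le_trans PE).
apply: le_trans (measure_sigma_subadditive P mA mUA (@subset_refl _ _)) _.
set e := expR _.
(* the factor of the i-th variable; the index n is the interval that contains t *)
pose f n (i : nat) (u : R * R) : R :=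
  if (i < n)%N then expR (x * u.1 + y * u.2) else 1 + expR (x * u.1 + 0 * u.2).
have mf n i : measurable_fun setT (f n i).
  rewrite /f; case: (i < n)%N; first exact: measurable_explin.
  by apply: measurable_funD => //; exact: measurable_explin.
have f0 n i u : 0 <= f n i u.
  by rewrite /f; case: (i < n)%N; rewrite ?addr_ge0// expR_ge0.
have intf n i : (\int[psi]_u (f n i u)%:E)%E =
    (if (i < n)%N then q%:E else (1 + c)%:E).
  rewrite /f; case: (i < n)%N; first exact: xyq.
  rewrite ge0_integral_EFinD//; last exact: measurable_explin.
  rewrite -/(mgf x 0) xc EFin_Rintegral ?integrable1// Rintegral_cst1.
  by rewrite EFinD.
have mprod n : measurable_fun setT (fun w => \prod_(i < n.+1) f n i (X i w)).
  by apply: measurable_prod => i _; exact: measurableT_comp.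
have bA n : (P (A n) <= ((1 + c) * e * q ^+ n)%:E)%E.
  have -> : (((1 + c) * e * q ^+ n)%:E =
      \int[P]_w (e * \prod_(i < n.+1) f n i (X i w))%:E)%E.
    rewrite ge0_integral_EFinZ ?expR_ge0//; last first.
      by move=> w; apply: prodr_ge0.
    rewrite (expectation_prod_iid X_iid n.+1 (f := f n))//; last first.
      by move=> i; rewrite intf; case: ifP => _; rewrite ltry.
    rewrite big_ord_recr/= intf ltnn.
    under eq_bigr do rewrite intf ltn_ord.
    by rewrite prodEFin prodr_const card_ord -!EFinM; congr EFin; ring.
  apply: prob_le_integral => //.
  - by apply: measurable_funM.
  - by move=> w; rewrite mulr_ge0 ?expR_ge0// prodr_ge0.
  move=> w [[/= St tS] yV].
  rewrite big_ord_recr/= {2}/f ltnn.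
  under eq_bigr do rewrite /f ltn_ord.
  rewrite -expR_sum.
  have -> : \sum_(i < n) (x * (X i w).1 + y * (X i w).2) = x * S n w + y * V n w.
    by rewrite big_split/= /renewal_time /reward_sum !mulr_sumr.
  rewrite mulrA /e -expRD.
  rewrite mul0r addr0.
  have [x0|x0] := leP 0 x.
    apply: (@le_trans _ _ (expR (- (x + z * y) * t + (x * S n w + y * V n w)) *
       expR (x * (X n w).1))); last by rewrite ler_wpM2l ?expR_ge0// lerDr.
    rewrite -expRD -[leLHS]expR0 ler_expR.
    by rewrite renewal_timeS in tS; nra.
  apply: (@le_trans _ _ (expR (- (x + z * y) * t + (x * S n w + y * V n w)) * 1)); last first.
    by rewrite ler_wpM2l ?expR_ge0// lerDl expR_ge0.
  by rewrite mulr1 -[leLHS]expR0 ler_expR; nra.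
apply: (@le_trans _ _ (\sum_(0 <= n <oo) ((1 + c) * e * q ^+ n)%:E)%E).
  by apply: lee_nneseries => [n _ _|n _]; [exact: measure_ge0|exact: bA].
have -> : (1 + c) / (1 - q) * e = (1 + c) * e / (1 - q) by rewrite mulrAC.
apply: geometric_eseries_le; last by rewrite q0.
by rewrite mulr_ge0 ?expR_ge0// addr_ge0.
Qed.

End upper_bound.

(** * Exponentially decaying events *)

Lemma le_oppe_lt (R : realType) (L x : \bar R) : (0 <= x)%E ->
  (forall c : R, (c%:E < x)%E -> (L <= (- c)%:E)%E) -> (L <= - x)%E.
Proof.
case: x => [r| |] // _ H.
  apply/lee_addgt0Pr => e e0.
  have := H (r - e); rewrite lte_fin gtrBl => /(_ e0) /le_trans; apply.
  by rewrite -EFinN -EFinD lee_fin opprB addrC.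
case: L H => [l| |] H //.
  have := H (- l + 1) (ltry _); rewrite lee_fin opprD opprK.
  by rewrite lerDl oppr_ge0 ler10.
by have := H 0 (ltry _); rewrite leye_eq.
Qed.

(** Applied to the distances to m, on one side, of the points of a closed set, this
    gives the nearest one. *)
Lemma closed_ge0_min (R : realType) (D : set R) : closed D -> D !=set0 ->
  (forall u, D u -> 0 <= u) -> exists2 u, D u & forall v, D v -> u <= v.
Proof.
move=> cD D0 Dge; have hi : has_inf D by split => //; exists 0 => u /Dge.
exists (inf D); last by move=> v Dv; exact: (ge_inf hi.2).
apply: itv_closed_infimums => //; split.
  by move=> v Dv; exact: (ge_inf hi.2).
by move=> v Hv; apply: lb_le_inf.
Qed.

Section exponential_decay.
Context (R : realType) d (Omega : measurableType d) (P : probability Omega R).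

Definition exp_decay (E : R -> set Omega) (c : R) := exists2 K, 0 <= K &
  forall t, 0 < t -> (P (E t) <= (K * expR (- c * t))%:E)%E.

Lemma exp_decay_sub (E F : R -> set Omega) c : (forall t, measurable (E t)) ->
  (forall t, measurable (F t)) -> (forall t, 0 < t -> E t `<=` F t) ->
  exp_decay F c -> exp_decay E c.
Proof.
move=> mE mF EF [K K0 H]; exists K => // t t0; apply: le_trans (H t t0).
by apply: le_measure; rewrite ?inE//; exact: EF.
Qed.

Lemma exp_decayU (E F : R -> set Omega) c : (forall t, measurable (E t)) ->
  (forall t, measurable (F t)) -> exp_decay E c -> exp_decay F c ->
  exp_decay (fun t => E t `|` F t) c.
Proof.
move=> mE mF [K K0 H] [K' K'0 H']; exists (K + K'); first exact: addr_ge0.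
move=> t t0; apply: le_trans (measureU2 _ (mE t) (mF t)) _.
by rewrite mulrDl EFinD; apply: leeD; [exact: H|exact: H'].
Qed.

Lemma exp_decay_le0 (E : R -> set Omega) c : (forall t, measurable (E t)) ->
  c <= 0 -> exp_decay E c.
Proof.
move=> mE c0; exists 1 => // t t0; apply: le_trans (probability_le1 _ (mE t)) _.
by rewrite mul1r lee_fin -expR0 ler_expR mulr_ge0 ?oppr_ge0 ?(ltW t0).
Qed.

Lemma exp_decay0 c : exp_decay (fun=> set0) c.
Proof.
by exists 0 => // t t0; rewrite measure0 mul0r.
Qed.

Lemma exp_decay_limsup (E : R -> set Omega) c : exp_decay E c ->
  (limsup_log_prob P E <= (- c)%:E)%E.
Proof.
move=> [K K0 H]; apply/lee_addgt0Pr => e e0.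
have K1 : 0 < K + 1 by rewrite ltr_wpDl.
pose t0 := Num.max 1 (ln (K + 1) / e).
apply: (@le_trans _ _ (ereal_sup (log_prob_rate P E @` [set t | t0 < t]))).
  apply: ereal_inf_lbound; exists [set t | t0 < t] => //.
  by exists t0; split => //; exact: num_real.
apply: ge_ereal_sup => _ [t /= t0t <-].
have tpos : 0 < t by apply: lt_trans t0t; rewrite lt_max ltr01.
have lnt : ln (K + 1) <= e * t.
  rewrite mulrC -ler_pdivrMr//; apply: le_trans (ltW t0t).
  by rewrite le_max lexx orbT.
rewrite /log_prob_rate lee_pdivrMl//.
apply: (@le_trans _ _ (lne ((K + 1) * expR (- c * t))%:E)).
  rewrite lee_lne; last 2 first.
  - by rewrite in_itv/= leey measure_ge0.
  - by rewrite in_itv/= leey lee_fin mulr_ge0 ?expR_ge0// ltW.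
  apply: le_trans (H t tpos) _; rewrite lee_fin ler_wpM2r ?expR_ge0//.
  by rewrite lerDl.
rewrite lne_EFin ?mulr_gt0 ?expR_gt0// lnM ?posrE ?expR_gt0// expRK.
rewrite -EFinD -EFinM lee_fin; lra.
Qed.

End exponential_decay.

Section upper.
Context (R : realType) d (Omega : measurableType d) (P : probability Omega R).
Context (psi : probability (R * R)%type R).
Context (X : nat -> {RV P >-> (R * R)%type}).
Hypothesis psi_pos : psi (`]0, +oo[ `*` [set: R]) = 1%E.
Hypothesis X_iid : iid_with_law psi X.
Hypothesis theta0_gt0 : (0 < theta0 psi)%E.
Hypothesis eta0_gt0 : (0 < eta0 psi)%E.
Local Notation mgf := (mgf psi).
Local Notation m := (mean_W psi / mean_tau psi).
Local Notation Z := (reward X).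

Lemma exp_decay_mgf_lt1 (x y z c : R) (l : R) : l < 0 ->
  (mgf x 0 < +oo)%E -> (mgf x y <= (expR l)%:E)%E -> c <= x + z * y ->
  exp_decay P (fun t => [set w | 0 <= y * (Z t w - z * t)]) c.
Proof.
move=> l0 /(mgf_lty_log psi_pos theta0_gt0 eta0_gt0)[a xa] xy cz.
have [b yb] := mgf_lty_log psi_pos theta0_gt0 eta0_gt0 (le_lt_trans xy (ltry _)).
have b0 : b < 0.
  by apply: le_lt_trans l0; rewrite yb lee_fin ler_expR in xy.
have q1 : expR b < 1 by rewrite -expR0 ltr_expR.
have [K K0 H] := upper_exponential_bound psi_pos X_iid theta0_gt0 eta0_gt0 z xa yb q1.
exists K => // t t0; apply: le_trans (H t (ltW t0)) _.
by rewrite lee_fin ler_wpM2l// ler_expR ler_pM2r// lerN2.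
Qed.

(** A small admixture of (-1, 0) makes the constraint strict, at an arbitrarily
    small cost in the rate. *)
Lemma exp_decay_mgf_le1 (x y z c : R) :
  (mgf x 0 < +oo)%E -> (mgf x y <= 1)%E -> 0 <= c < x + z * y ->
  exp_decay P (fun t => [set w | 0 <= y * (Z t w - z * t)]) c.
Proof.
move=> x0 xy /andP[c0 cz].
pose s := x + z * y.
(* any weight between (c + 1) / (s + 1) and 1 keeps the rate above c *)
pose l := (1 + (c + 1) / (s + 1)) / 2.
have s1 : 0 < s + 1 by rewrite /s; lra.
have cs : (c + 1) / (s + 1) < 1 by rewrite ltr_pdivrMr// mul1r ltrD2r.
have cs0 : 0 < (c + 1) / (s + 1) by rewrite divr_gt0// ltr_wpDl.
have l1 : l < 1 by rewrite /l; lra.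
have l0 : 0 < l by rewrite /l; lra.
have l01 : 0 <= l <= 1 by rewrite !ltW.
have cl : c <= l * s - (1 - l).
  suff : c + 1 <= l * (s + 1) by lra.
  by rewrite -ler_pdivrMr// /l; lra.
have [u u0 Eu] := mgfN1_lt1 psi_pos theta0_gt0 eta0_gt0.
have [a xa] := mgf_lty_log psi_pos theta0_gt0 eta0_gt0 x0.
have H1 := mgf_epi_convex l01 (_ : mgf x y <= (expR 0)%:E)%E (_ : mgf (-1) 0 <= (expR u)%:E)%E.
rewrite expR0 Eu lexx in H1; have {}H1 := H1 xy isT.
have H2 := mgf_epi_convex l01 (_ : mgf x 0 <= (expR a)%:E)%E (_ : mgf (-1) 0 <= (expR u)%:E)%E.
rewrite xa Eu !lexx in H2; have {}H2 := H2 isT isT.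
rewrite !mulr0 addr0 in H2; rewrite !mulr0 addr0 add0r in H1.
have u1 : (1 - l) * u < 0 by rewrite nmulr_llt0// subr_gt0.
have H := exp_decay_mgf_lt1 u1 (le_lt_trans H2 (ltry _)) H1 (_ : c <= _ + z * (l * y)).
apply: exp_decay_sub (H _).
- by move=> t; apply: measurable_affine_ge0; exact: measurable_reward.
- by move=> t; apply: measurable_affine_ge0; exact: measurable_reward.
- by move=> t t0 w /= h; rewrite -mulrA mulr_ge0// ltW.
- apply: le_trans cl _; rewrite le_eqVlt; apply/orP; left; apply/eqP.
  by rewrite /s; ring.
Qed.

(** The factor k = eta / (eta + |y|) is the largest one for which Young's
    inequality gives E exp (k x tau) < +oo; the point is scaled by a factor
    slightly below k, which keeps it in the level set by convexity. *)
Lemma exp_decay_exp_moment (x y z c eta : R) : 0 < eta ->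
  (\int[psi]_z (expR (eta * `|z.2|))%:E < +oo)%E ->
  (mgf x y <= 1)%E -> 0 <= c -> c * (eta + `|y|) < eta * (x + z * y) ->
  exp_decay P (fun t => [set w | 0 <= y * (Z t w - z * t)]) c.
Proof.
move=> eta0 Eeta xy c0 cs; pose s := x + z * y.
have y0 := normr_ge0 y.
have ey : 0 < eta + `|y| by rewrite ltr_wpDr.
have s0 : 0 < s.
  rewrite -(pmulr_rgt0 _ eta0); apply: le_lt_trans cs.
  by rewrite mulr_ge0// ltW.
(* above c / s the rate exceeds c, below eta / (eta + |y|) Young applies *)
pose k := (eta / (eta + `|y|) + c / s) / 2.
have ck : c / s < eta / (eta + `|y|).
  by rewrite ltr_pdivrMr// mulrAC ltr_pdivlMr.
have cs0 : 0 <= c / s by rewrite divr_ge0// ltW.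
have e1 : eta / (eta + `|y|) <= 1 by rewrite ler_pdivrMr// mul1r lerDl.
have k0 : 0 < k by rewrite /k; lra.
have k1 : k < 1 by rewrite /k; lra.
have kc : c < k * s by rewrite -ltr_pdivrMr// /k; lra.
have ky : k * `|y| <= (1 - k) * eta.
  suff : k * (eta + `|y|) <= eta by lra.
  by rewrite -ler_pdivlMr// /k; lra.
have k01 : 0 <= k < 1 by rewrite k1 ltW.
have M1 := mgf_young k01 ky (le_lt_trans xy (ltry _)) Eeta.
have k01' : 0 <= k <= 1 by rewrite !ltW.
have M2 := mgf_epi_convex k01' (_ : mgf x y <= (expR 0)%:E)%E (_ : mgf 0 0 <= (expR 0)%:E)%E.
rewrite expR0 mgf00 lexx !mulr0 !addr0 expR0 in M2.
have {}M2 := M2 xy isT.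
have H := exp_decay_mgf_le1 M1 M2 (_ : 0 <= c < _ + z * (k * y)).
apply: exp_decay_sub (H _).
- by move=> t; apply: measurable_affine_ge0; exact: measurable_reward.
- by move=> t; apply: measurable_affine_ge0; exact: measurable_reward.
- by move=> t t0 w /= h; rewrite -mulrA mulr_ge0// ltW.
- rewrite c0/=; apply: lt_le_trans kc _; rewrite le_eqVlt; apply/orP; left; apply/eqP.
  by rewrite /s; ring.
Qed.

(** Here sg is 1 or -1 and covers both half-lines. A point (x, y) of the level set
    with x + z y > c has sg y > 0, since x + m y <= 0; shifting the target from
    z to z + sg b raises x + z y by b |y|, which offsets the factor
    eta / (eta + |y|) when c < eta b. If eta0 is infinite, this factor is as
    close to 1 as desired and b = 0 is possible. *)
Lemma exp_decay_half_line (sg z b c : R) : sg ^+ 2 = 1 -> 0 <= sg * (z - m) -> 0 <= b ->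
  0 <= c -> (c%:E < cost psi z)%E ->
  eta0 psi = +oo%E \/ (c%:E < eta0 psi * b%:E)%E ->
  exp_decay P (fun t => [set w | 0 <= sg * (Z t w - (z + sg * b) * t)]) c.
Proof.
move=> sg2 sz b0 c0 /lt_cost[x [y [xy cz]]] etab.
have xm := mgf_le1_mean psi_pos theta0_gt0 eta0_gt0 xy.
pose y' := sg * y.
have yE : y = sg * y' by rewrite /y' mulrA -expr2 sg2 mul1r.
have y'0 : 0 < y'.
  rewrite ltNge; apply/negP => y'0.
  have : (sg * (z - m)) * y' <= 0 by rewrite mulr_ge0_le0.
  rewrite mulrAC -yE; lra.
have sg1 : `|sg| = 1.
  by apply/eqP; rewrite -sqrp_eq1// -normrX sg2 normr1.
have yn : `|y| = y' by rewrite yE normrM sg1 mul1r gtr0_norm.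
have sE : x + (z + sg * b) * y = x + z * y + b * y'.
  by rewrite mulrDl addrA; congr (_ + _); rewrite /y'; ring.
have [eta [e0 Ee He]] : exists eta, [/\ 0 < eta,
    (\int[psi]_z (expR (eta * `|z.2|))%:E < +oo)%E &
    c * (eta + `|y|) < eta * (x + (z + sg * b) * y)].
  have by0 : 0 <= b * y' by rewrite mulr_ge0// ltW.
  case: (eqVneq (eta0 psi) +oo%E) => [etay|etany].
    (* chosen so that eta (x + z y - c) exceeds c |y| *)
    exists ((c * y' + 1) / (x + z * y - c)).
    have d0 : 0 < x + z * y - c by rewrite subr_gt0.
    have n0 : 0 < c * y' + 1 by rewrite ltr_wpDl// mulr_ge0// ltW.
    have e0 : 0 < (c * y' + 1) / (x + z * y - c) by rewrite divr_gt0.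
    split => //; first by apply: lt_eta0_exp_moment; rewrite etay ltry.
    rewrite sE yn.
    have E : (c * y' + 1) / (x + z * y - c) * (x + z * y - c) = c * y' + 1.
      by rewrite divfK// gt_eqF.
    have := mulr_ge0 (ltW e0) by0; lra.
  case: etab => [/eqP|]; first by rewrite (negbTE etany).
  case E : (eta0 psi) eta0_gt0 etany => [e| |]//; rewrite lte_fin => e0 _.
  rewrite -EFinM lte_fin => ceb.
  have bpos : 0 < b by rewrite -(pmulr_rgt0 _ e0); apply: le_lt_trans ceb.
  have cbe : c / b < e by rewrite ltr_pdivrMr.
  have cb0 : 0 <= c / b by rewrite divr_ge0.
  exists ((c / b + e) / 2); split.
  - lra.
  - by apply: lt_eta0_exp_moment; rewrite E lte_fin; lra.
  set et := _ / 2.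
  have ceb' : c < et * b by rewrite -ltr_pdivrMr// /et; lra.
  have et0 : 0 < et by rewrite /et; lra.
  rewrite sE yn.
  have h1 : c * y' < et * b * y' by rewrite ltr_pM2r.
  have h2 : et * c < et * (x + z * y) by rewrite ltr_pM2l.
  lra.
apply: exp_decay_sub (exp_decay_exp_moment e0 Ee xy c0 He).
- by move=> t; apply: measurable_affine_ge0; exact: measurable_reward.
- by move=> t; apply: measurable_affine_ge0; exact: measurable_reward.
- move=> t t0 w /= h.
  by rewrite [X in X * _]yE mulrAC mulr_ge0// ltW.
Qed.

End upper.

(** * Upper bounds for closed sets and tails *)

Lemma eta0_bounded (R : realType) (psi : probability (R * R)%type R) (K : R) :
  {ae psi, forall z, `|z.2| <= K} -> eta0 psi = +oo%E.
Proof.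
move=> WK; apply: eq_infty => r.
apply: (@le_trans _ _ `|r|%:E); first by rewrite lee_fin ler_norm.
apply: ereal_sup_ubound; exists `|r| => //; split => //.
rewrite expectationE.
apply: (@le_lt_trans _ _ (\int[psi]_z (expR (`|r| * K))%:E)%E); last first.
  by rewrite EFin_Rintegral ?ltry//; exact: finite_measure_integrable_cst.
apply: ge0_integral_EFin_ae_le.
- apply: measurableT_comp => //; apply: measurable_funM => //.
  exact: measurableT_comp.
- exact: measurable_cst.
- by move=> z; exact: expR_ge0.
- by move=> z; exact: expR_ge0.
by apply: filterS WK => z zK; rewrite ler_expR ler_wpM2l.
Qed.

Section upper_theorems.
Context (R : realType) d (Omega : measurableType d) (P : probability Omega R).
Context (psi : probability (R * R)%type R).
Context (X : nat -> {RV P >-> (R * R)%type}).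
Hypothesis psi_pos : psi (`]0, +oo[ `*` [set: R]) = 1%E.
Hypothesis X_iid : iid_with_law psi X.
Hypothesis theta0_gt0 : (0 < theta0 psi)%E.
Hypothesis eta0_gt0 : (0 < eta0 psi)%E.
Local Notation m := (mean_W psi / mean_tau psi).
Local Notation Z := (reward X).

Lemma Jbar_ge0 z : (0 <= Jbar psi z)%E.
Proof.
have J0 u : (0 <= J psi u)%E by apply: le_trans (le_cost_J psi u); exact: cost_ge0.
by rewrite /Jbar; case: eqP => // _; rewrite le_min J0/= ltW.
Qed.

Lemma Jbar_le_J z : (Jbar psi z <= J psi z)%E.
Proof. by rewrite /Jbar; case: eqP => // ->; rewrite ge_min lexx. Qed.

Lemma measurable_velocity_closed t (C : set R) : closed C ->
  measurable ((fun w => Z t w / t) @^-1` C).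
Proof.
move=> cC; rewrite -[_ @^-1` _]setTI; apply: measurable_velocity => //.
exact: closed_measurable.
Qed.

(** Beyond m, on either side, the closed set is contained in the half-line
    that starts at its nearest point to m, so the bounds for half-lines
    suffice. *)
Lemma ldp_upper_closed (C : set R) : eta0 psi = +oo%E -> closed C ->
  (limsup_log_prob P (fun t => (fun w => (Z t w / t)%R) @^-1` C) <=
    - ereal_inf (Jbar psi @` C))%E.
Proof.
move=> etay cC.
have JE : Jbar psi = cost psi by apply/funext => z; exact: Jbar_cost.
rewrite JE; apply: le_oppe_lt.
  by apply: le_ereal_inf_tmp => _ [z _ <-]; exact: cost_ge0.
move=> c cinf; apply: exp_decay_limsup.
have [c0|c0] := leP 0 c; last first.
  by apply: exp_decay_le0 (ltW c0) => t; exact: measurable_velocity_closed.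
have costC z : C z -> (c%:E < cost psi z)%E.
  by move=> Cz; apply: lt_le_trans cinf _; apply: ereal_inf_lbound; exists z.
pose E sg t := ((fun w => Z t w / t) @^-1` C) `&` [set w | 0 <= sg * (Z t w / t - m)].
have mE sg t : measurable (E sg t).
  apply: measurableI; first exact: measurable_velocity_closed.
  by apply: (measurable_affine_ge0 sg m); exact: measurable_velocity.
have dec sg : sg ^+ 2 = 1 -> exp_decay P (E sg) c.
  move=> sg2; pose D := [set u | C (m + sg * u)] `&` [set u : R | 0 <= u].
  have inD t w : 0 < t -> E sg t w -> D (sg * (Z t w / t - m)).
    move=> t0 [/= h1 h2]; split => //=.
    by rewrite mulrA -expr2 sg2 mul1r addrC subrK.
  have [D0|D0] := pselect (D !=set0); last first.
    apply: exp_decay_sub (exp_decay0 P c) => // t t0 w Ew.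
    by apply: D0; eexists; exact: inD Ew.
  have cD : closed D.
    apply: closedI; last exact: closed_ge.
    apply: preimage_closed cC => u _ .
    by apply: cvgD; [exact: cvg_cst|apply: cvgMr; exact: cvg_id].
  have [u [Cu /= u0] umin] := closed_ge0_min cD D0 (fun u h => proj2 h).
  have H : 0 <= sg * (m + sg * u - m).
    by rewrite addrAC subrr add0r mulrA -expr2 sg2 mul1r.
  have := exp_decay_half_line psi_pos X_iid theta0_gt0 eta0_gt0 sg2 H (lexx 0) c0
     (costC _ Cu) (or_introl etay).
  apply: exp_decay_sub => //.
    by move=> t; apply: measurable_affine_ge0; exact: measurable_reward.
  move=> t t0 w Ew /=; have := umin _ (inD t w t0 Ew).
  rewrite mulr0 addr0 -subr_ge0 => h.
  have := mulr_ge0 h (ltW t0).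
  have -> : (sg * (Z t w / t - m) - u) * t = sg * (Z t w - (m + sg * u) * t) + (sg ^+ 2 - 1) * u * t.
    by move: (mean_W _ / _) => mu; field; rewrite gt_eqF.
  by rewrite sg2 subrr !mul0r addr0.
have sqN1 : (-1) ^+ 2 = 1 :> R by rewrite sqrrN expr1n.
have H := exp_decayU (mE 1) (mE (-1)) (dec 1 (expr1n _ _)) (dec (-1) sqN1).
apply: exp_decay_sub H.
- by move=> t; exact: measurable_velocity_closed.
- by move=> t; exact: measurableU.
- move=> t t0 w Cw; have [h|h] := leP m (Z t w / t).
    by left; split => //=; rewrite mul1r subr_ge0.
  by right; split => //=; rewrite mulN1r oppr_ge0 subr_le0 ltW.
Qed.

(** With b = a (1 - kappa) / 4, the point m + sg (a - b) lies strictly beyond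
    m + sg kappa a. There remains room to move it towards m until J is below its
    cost, while staying in the range of the infimum. *)
Lemma limsup_tail_le (sg a kappa : R) (E : R -> set Omega) (I : set R) :
  sg ^+ 2 = 1 -> 0 < a -> 0 < kappa < 1 -> (forall t, measurable (E t)) ->
  (forall t w, 0 < t -> E t w -> a <= sg * (Z t w / t - m)) ->
  (forall z, kappa * a <= sg * (z - m) -> I z) ->
  (limsup_log_prob P E <= - mine (ereal_inf (Jbar psi @` I))
     (eta0 psi * (a * (1 - kappa) / 4)%:E))%E.
Proof.
move=> sg2 a0 /andP[k0 k1] mE EZ Iz.
pose b := a * (1 - kappa) / 4.
have b0 : 0 < b by rewrite /b !mulr_gt0// subr_gt0.
apply: le_oppe_lt.
  rewrite le_min; apply/andP; split.
    by apply: le_ereal_inf_tmp => _ [z _ <-]; exact: Jbar_ge0.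
  by apply: mule_ge0; [exact: ltW|rewrite lee_fin ltW].
move=> c; rewrite lt_min => /andP[cinf ceta]; apply: exp_decay_limsup.
have [c0|c0] := leP 0 c; last exact: exp_decay_le0 (ltW c0).
pose z := m + sg * (a - b).
have zm : sg * (z - m) = a - b.
  by rewrite /z addrAC subrr add0r mulrA -expr2 sg2 mul1r.
have ab : a - b = a * (3 + kappa) / 4 by rewrite /b; field.
have k3 : 0 < 3 + kappa by lra.
have ab0 : 0 < a - b by rewrite ab !mulr_gt0.
have costz : (c%:E < cost psi z)%E.
  rewrite ltNge; apply/negP => cz.
  (* the weight for which (1 - l) (a - b) = kappa a *)
  pose l := 1 - 4 * kappa / (3 + kappa).
  have l1 : 4 * kappa / (3 + kappa) < 1 by rewrite ltr_pdivrMr//; lra.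
  have l2 : 0 < 4 * kappa / (3 + kappa) by rewrite divr_gt0// mulr_gt0.
  have l01 : 0 < l <= 1 by rewrite /l; lra.
  have := J_segment_le psi_pos theta0_gt0 eta0_gt0 l01 cz.
  set z' := _ + _ => Jz'.
  have Iz' : I z'.
    apply: Iz.
    have -> : sg * (z' - m) = (1 - l) * (sg * (z - m)) by rewrite /z'; ring.
    rewrite zm ab le_eqVlt; apply/orP; left; apply/eqP; rewrite /l.
    by field; rewrite gt_eqF.
  have : (ereal_inf (Jbar psi @` I) <= c%:E)%E.
    apply: (@le_trans _ _ (Jbar psi z')); first by apply: ereal_inf_lbound; exists z'.
    apply: (le_trans (Jbar_le_J z')); apply: (le_trans Jz').
    by rewrite lee_fin ler_piMl//; rewrite /l; lra.
  by rewrite leNgt cinf.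
have := exp_decay_half_line psi_pos X_iid theta0_gt0 eta0_gt0 sg2 _ (ltW b0) c0 costz (or_intror ceta).
rewrite zm => /(_ (ltW ab0)); apply: exp_decay_sub => //.
  by move=> t; apply: measurable_affine_ge0; exact: measurable_reward.
move=> t t0 w Ew /=; have := EZ t w t0 Ew; rewrite -subr_ge0 => h.
have := mulr_ge0 h (ltW t0).
have -> : (sg * (Z t w / t - m) - a) * t =
   sg * (Z t w - (z + sg * b) * t) + (sg ^+ 2 - 1) * a * t.
  by rewrite /z; move: (mean_W _ / _) => mu; field; rewrite gt_eqF.
by rewrite sg2 subrr !mul0r addr0.
Qed.

End upper_theorems.

(** * Chernoff bounds under a change of measure *)

Lemma expR_le_quadratic (R : realType) (x : R) :
  expR x <= 1 + x + x ^+ 2 * expR `|x|.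
Proof.
have h1 : expR x - 1 <= x * expR x.
  have : (1 - x) * expR x <= 1.
    have := ler_wpM2r (expR_ge0 x) (expR_ge1Dx (- x)).
    by rewrite -expRD addNr expR0.
  by lra.
have [x0|x0] := leP 0 x.
  rewrite ger0_norm//; have := ler_wpM2l x0 h1; nra.
have h2 := expR_ge1Dx x.
have h3 : 1 <= expR `|x| by rewrite -[leLHS]expR0 ler_expR.
have : x * (expR x - 1) <= x ^+ 2 by nra.
have : x ^+ 2 <= x ^+ 2 * expR `|x| by rewrite ler_peMr// sqr_ge0.
have : expR x - 1 - x <= x * (expR x - 1) by nra.
lra.
Qed.

(** A second-order expansion of exp whose remainder is controlled by exp G; it
    yields the derivative at 0 of a Laplace transform without differentiating
    under the integral. *)
Lemma expR_small_slope (R : realType) (h x G : R) : 0 < h <= 2^-1 -> 0 <= G ->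
  `|x| <= h * G -> expR x <= 1 + x + 8 * h ^+ 2 * expR G.
Proof.
move=> /andP[h0 h1] G0 xG; apply: le_trans (expR_le_quadratic x) _.
rewrite lerD2l.
have G2 : G ^+ 2 <= 8 * expR (G / 2).
  have /(expR_ge1Dxn 1) : 0 <= G / 2 by rewrite divr_ge0.
  by rewrite (_ : 2`!%:R = 2 :> R)// => H; nra.
have e1 : expR `|x| <= expR (G / 2) by rewrite ler_expR (le_trans xG)//; nra.
have x2 : x ^+ 2 <= h ^+ 2 * G ^+ 2.
  by rewrite -exprMn -[leLHS]real_normK ?num_real// lerXn2r// nnegrE mulr_ge0// ltW.
have eG : expR G = expR (G / 2) * expR (G / 2) by rewrite -expRD; congr expR; lra.
apply: (@le_trans _ _ (h ^+ 2 * G ^+ 2 * expR (G / 2))).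
  by apply: ler_pM => //; rewrite ?sqr_ge0 ?expR_ge0.
have := ler_wpM2r (expR_ge0 (G / 2)) (ler_wpM2l (sqr_ge0 h) G2).
by rewrite eG; lra.
Qed.

Section chernoff.
Context (R : realType) (psi : probability (R * R)%type R).
Variables (phi : R * R -> R) (s : R).
Hypothesis mphi : measurable_fun setT phi.
Hypothesis phi0 : forall u, 0 <= phi u.
Hypothesis s0 : 0 < s.
Hypothesis phi_int : (\int[psi]_u (phi u)%:E = 1)%E.
Hypothesis phi_exp :
  (\int[psi]_u (phi u * expR (s * `|u.1| + s * `|u.2|))%:E < +oo)%E.

Local Notation G u := (s * (1 + `|u.1| + `|u.2|)).

Lemma measurable_phi_exp :
  measurable_fun setT (fun u : R * R => phi u * expR (G u)).
Proof.
apply: measurable_funM => //; apply: measurableT_comp => //.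
apply: measurable_funM => //; apply: measurable_funD; last exact: measurableT_comp.
by apply: measurable_funD => //; exact: measurableT_comp.
Qed.

Lemma integrable_phi_exp :
  psi.-integrable setT (EFin \o (fun u : R * R => phi u * expR (G u))).
Proof.
apply: ge0_fin_integrable; first exact: measurable_phi_exp.
  by move=> u; rewrite mulr_ge0 ?expR_ge0.
have -> : (fun u : R * R => (phi u * expR (G u))%:E) =
   (fun u : R * R => (expR s * (phi u * expR (s * `|u.1| + s * `|u.2|)))%:E).
  apply/funext => u; congr EFin.
  by rewrite mulrCA -expRD; congr (_ * expR _); ring.
rewrite ge0_integral_EFinZ ?expR_ge0//.
- case: (\int[psi]_u _)%E phi_exp => [r| |] // _; first by rewrite -EFinM ltry.
  by rewrite mulrNy gtr0_sg ?expR_gt0// mul1e.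
- apply: measurable_funM => //; exact: measurable_exp_abs.
- by move=> u; rewrite mulr_ge0 ?expR_ge0.
Qed.

Lemma integrable_phi : psi.-integrable setT (EFin \o phi).
Proof. by apply: ge0_fin_integrable => //; rewrite phi_int ltry. Qed.

Lemma integrable_phiM (F : R * R -> R) (B : R) : measurable_fun setT F ->
  (forall u, `|F u| <= B * (1 + `|u.1| + `|u.2|)) -> 0 < B ->
  psi.-integrable setT (EFin \o (fun u => phi u * F u)).
Proof.
move=> mF FB B0.
have Hi := @integrableZl _ _ _ psi setT measurableT (B / s) _ integrable_phi_exp.
apply: le_integrable Hi => //; first exact/measurable_EFinP/measurable_funM.
move=> u _; rewrite /= lee_fin normrM (ger0_norm (phi0 u)) [leRHS]ger0_norm; last first.
  by rewrite !mulr_ge0 ?expR_ge0 ?invr_ge0// ltW.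
rewrite mulrCA ler_wpM2l//; apply: le_trans (FB u) _.
rewrite -mulrA ler_pM2l// ler_pdivlMl//.
by apply: le_trans (expR_ge1Dx _); rewrite lerDr.
Qed.

(** The Laplace transform of F under the density phi is 1 at 0, with
    negative slope there, hence below 1 at some small positive parameter. *)
Lemma chernoff_negative_mean (F : R * R -> R) (B : R) : measurable_fun setT F ->
  (forall u, `|F u| <= B * (1 + `|u.1| + `|u.2|)) -> 0 < B ->
  \int[psi]_u (phi u * F u) < 0 ->
  exists sg rho, [/\ 0 < sg, 0 <= rho < 1 &
    (\int[psi]_u (phi u * expR (sg * F u))%:E <= rho%:E)%E].
Proof.
move=> mF FB B0; set A := \int[psi]_u _ => A0.
have iF := integrable_phiM mF FB B0.
set C := \int[psi]_u (phi u * expR (G u)).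
have C0 : 0 <= C.
  by apply: Rintegral_ge0 => u _; rewrite mulr_ge0 ?expR_ge0.
pose a := - (s / B * A).
have a0 : 0 < a by rewrite /a oppr_gt0 pmulr_rlt0// divr_gt0.
(* the linear gain h a outweighs the quadratic remainder 8 h^2 C *)
pose h := Num.min 2^-1 (a / (16 * (C + 1))).
have C1 : 0 < 16 * (C + 1) by rewrite mulr_gt0// ltr_wpDl.
have h0 : 0 < h by rewrite /h lt_min invr_gt0 ltr0n divr_gt0.
have h1 : h <= 2^-1 by rewrite /h ge_min lexx.
have h2 : h * (16 * (C + 1)) <= a.
  by rewrite -ler_pdivlMr// /h ge_min lexx orbT.
pose sg := h * (s / B).
have sg0 : 0 < sg by rewrite mulr_gt0// divr_gt0.
pose f u := phi u * 1 + sg * (phi u * F u) + 8 * h ^+ 2 * (phi u * expR (G u)).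
have le_f u : phi u * expR (sg * F u) <= f u.
  have GE : 0 <= G u by rewrite mulr_ge0 ?ltW// !addr_ge0.
  have sF : `|sg * F u| <= h * G u.
    rewrite normrM (gtr0_norm sg0) /sg -mulrA ler_pM2l//.
    apply: le_trans (ler_wpM2l _ (FB u)) _; first by rewrite divr_ge0// ltW.
    by rewrite mulrA divfK// gt_eqF.
  have := ler_wpM2l (phi0 u) (expR_small_slope (_ : 0 < h <= 2^-1) GE sF).
  rewrite h0 h1 => /(_ isT) H; apply: le_trans H _.
  by rewrite le_eqVlt; apply/orP; left; apply/eqP; rewrite /f; ring.
have i1 : psi.-integrable setT (EFin \o (fun u => phi u * 1)).
  by under eq_fun do rewrite mulr1; exact: integrable_phi.
have [i2 E2] := integrable_lin 1 sg i1 iF.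
have [i3 E3] := integrable_lin 1 (8 * h ^+ 2) i2 integrable_phi_exp.
have fE : \int[psi]_u f u = 1 + sg * A + 8 * h ^+ 2 * C.
  rewrite -/A -/C in E2 E3.
  transitivity (\int[psi]_x
       (1 * (1 * (phi x * 1) + sg * (phi x * F x)) +
        8 * h ^+ 2 * (phi x * expR (G x)))).
    by apply: eq_Rintegral => u _; rewrite !mul1r.
  rewrite E3 E2 !mul1r.
  have -> : \int[psi]_x (phi x * 1) = 1.
    rewrite /Rintegral; under eq_integral do rewrite mulr1.
    by rewrite phi_int.
  by [].
have fi : psi.-integrable setT (EFin \o f).
  apply: eq_integrable i3 => // u _ /=.
  by rewrite !mul1r.
have mf : measurable_fun setT f by apply/measurable_EFinP; exact: measurable_int fi.
have ml : measurable_fun setT (fun u => phi u * expR (sg * F u)).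
  apply: measurable_funM => //; apply: measurableT_comp => //.
  by apply: measurable_funM.
have le1 : (\int[psi]_u (phi u * expR (sg * F u))%:E <=
    (1 + sg * A + 8 * h ^+ 2 * C)%:E)%E.
  rewrite -fE -EFin_Rintegral//; apply: ge0_integral_EFin_le => //.
  by move=> u; rewrite mulr_ge0 ?expR_ge0.
exists sg, (1 + sg * A + 8 * h ^+ 2 * C); split => //.
apply/andP; split.
  rewrite -lee_fin; apply: le_trans le1.
  by apply: integral_ge0 => u _; rewrite lee_fin mulr_ge0 ?expR_ge0.
have -> : sg * A = - h * a by rewrite /sg /a; ring.
nra.
Qed.


Context d (Omega : measurableType d) (P : probability Omega R).
Context (X : nat -> {RV P >-> (R * R)%type}).
Hypothesis X_iid : iid_with_law psi X.

(** Under the product density of phi over the first N variables, each of the sums over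
    j >= n steps is nonnegative with probability at most rho ^+ n. On the
    complement the product density is at most D, so that the original
    probability of the good event is at least its tilted probability over D.
    The change of measure is only performed inside integrals, which avoids
    constructing the tilted process. *)
Lemma tilted_event_bound (I : finType) (F : I -> R * R -> R) (B : R) : 0 < B ->
  (forall k, measurable_fun setT (F k)) ->
  (forall k u, `|F k u| <= B * (1 + `|u.1| + `|u.2|)) ->
  (forall k, \int[psi]_u (phi u * F k u) < 0) ->
  exists2 rho, 0 <= rho < 1 & forall n N (D : R),
    let good := [set w | forall j k, (n <= j <= N)%N ->
                   \sum_(i < j) F k (X i w) < 0] in
    0 <= D -> (forall w, good w -> \prod_(i < N) phi (X i w) <= D) ->
    measurable good /\
    (1 <= D%:E * P good + ((N.+1 * #|I|)%:R * rho ^+ n)%:E)%E.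
Proof.
move=> B0 mF FB FN.
have /choice[sr Hsr] : forall k, exists sr : R * R, [/\ 0 < sr.1, 0 <= sr.2 < 1 &
    (\int[psi]_u (phi u * expR (sr.1 * F k u))%:E <= sr.2%:E)%E].
  by move=> k; have [sg [r H]] := chernoff_negative_mean (mF k) (FB k) B0 (FN k); exists (sg, r).
pose rho := \big[Num.max/0]_k (sr k).2.
have rho0 : 0 <= rho by exact: bigmax_ge_id.
have rho1 : rho < 1.
  by apply: bigmax_lt => // k _; case: (Hsr k) => _ /andP[].
have rhok k : (sr k).2 <= rho by exact: le_bigmax.
exists rho; first by rewrite rho0.
move=> n N D good D0 gD.
have mS j k : measurable_fun setT (fun w => \sum_(i < j) F k (X i w)).
  by apply: measurable_sum => i; exact: measurableT_comp.
have mgood : measurable good.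
  rewrite (_ : good = \bigcap_j \bigcap_(k in [set: I])
     (if (n <= j <= N)%N then ~` [set w | 0 <= \sum_(i < j) F k (X i w)] else setT)).
    apply: bigcapT_measurable => j; apply: fin_bigcap_measurable => [|k _].
      exact: finite_finset.
    case: ifP => // _; apply: measurableC.
    rewrite (_ : [set w | _] = ~` [set w | 0 < - \sum_(i < j) F k (X i w)]).
      by apply: measurableC; apply: measurable_lt_cst; apply: measurableT_comp.
    by apply/seteqP; split => w /=; rewrite oppr_gt0 leNgt => /negP.
  apply/seteqP; split => [w gw j _ k _|w H j k nj].
    by case: ifP => // nj /=; rewrite leNgt (gw _ _ nj).
  by have := H j Logic.I k Logic.I; rewrite nj /= => /negP; rewrite -ltNge.
split => //.
pose Q (N : nat) w := \prod_(i < N) phi (X i w).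
have mQ : measurable_fun setT (Q N).
  by apply: measurable_prod => i _; exact: measurableT_comp.
have Q0 w : 0 <= Q N w by apply: prodr_ge0.
pose T (p : 'I_N.+1 * I) w : R := if (n <= p.1)%N then
  Q N w * expR ((sr p.2).1 * \sum_(i < p.1) F p.2 (X i w)) else 0.
have mT p : measurable_fun setT (T p).
  rewrite /T; case: (n <= p.1)%N => //.
  apply: measurable_funM => //; apply: measurableT_comp => //.
  by apply: measurable_funM.
have T0 p w : 0 <= T p w by rewrite /T; case: ifP => // _; rewrite mulr_ge0 ?expR_ge0.
have intT p : (\int[P]_w (T p w)%:E <= (rho ^+ n)%:E)%E.
  rewrite /T; case: (boolP (n <= p.1)%N) => [np|_]; last first.
    by rewrite integral0_eq// lee_fin exprn_ge0.
  have [sg0 /andP[r0 r1] Hr] := Hsr p.2.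
  pose f i u := phi u * (if (i < p.1)%N then expR ((sr p.2).1 * F p.2 u) else 1).
  have pN : (p.1 <= N)%N by rewrite -ltnS.
  have -> : (fun w => (Q N w * expR ((sr p.2).1 * \sum_(i < p.1) F p.2 (X i w)))%:E) =
    (fun w => (\prod_(i < N) f i (X i w))%:E).
    apply/funext => w; congr EFin; rewrite /f big_split/=; congr (_ * _).
    rewrite mulr_sumr expR_sum.
    by rewrite (big_ord_widen N (fun i => expR ((sr p.2).1 * F p.2 (X i w))))// big_mkcond.
  have mf i : measurable_fun setT (f i).
    apply: measurable_funM => //; case: (i < p.1)%N => //.
    by apply: measurableT_comp => //; apply: measurable_funM.
  have f0 i u : 0 <= f i u.
    by rewrite /f mulr_ge0//; case: ifP => // _; exact: expR_ge0.
  have fi i : (\int[psi]_u (f i u)%:E <= (if (i < p.1)%N then (sr p.2).2 else 1)%:E)%E.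
    rewrite /f; case: ifP => _; first exact: Hr.
    by under eq_integral do rewrite mulr1; rewrite phi_int.
  rewrite (expectation_prod_iid X_iid N (f := f))//; last first.
    by move=> i; apply: le_lt_trans (fi i) (ltry _).
  apply: (@le_trans _ _ (\prod_(i < N) (if (i < p.1)%N then (sr p.2).2 else 1)%:E)%E).
    suff /andP[] : (0 <= \prod_(i < N) \int[psi]_u (f i u)%:E <=
        \prod_(i < N) (if (i < p.1)%N then (sr p.2).2 else 1)%:E)%E by [].
    elim/big_ind2 : _ => [|a b c e /andP[a0 ab] /andP[c0 ce]|i _].
    - by rewrite lee01 lexx.
    - by rewrite mule_ge0//= lee_pmul.
    - by rewrite fi andbT; apply: integral_ge0 => u _; rewrite lee_fin.
  rewrite prodEFin lee_fin -big_mkcond/= -(big_ord_widen N (fun=> (sr p.2).2))//.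
  rewrite prodr_const card_ord.
  apply: (@le_trans _ _ (rho ^+ p.1)); first by rewrite lerXn2r// nnegrE.
  by apply: ler_wiXn2l => //; exact: ltW.
have ptw w : Q N w <= D * \1_good w + \sum_p T p w.
  have sT : 0 <= \sum_p T p w by apply: sumr_ge0 => p _.
  have [gw|ngw] := pselect (good w).
    by rewrite indicE mem_set// mulr1 (le_trans (gD w gw))// lerDl.
  rewrite indicE memNset// mulr0 add0r.
  have [j [k [/andP[nj jN] Sjk]]] : exists j k, (n <= j <= N)%N /\
      0 <= \sum_(i < j) F k (X i w).
    apply: contrapT => H; apply: ngw => j k njN; rewrite ltNge; apply/negP => S0.
    by apply: H; exists j, k.
  have jN1 : (j < N.+1)%N by rewrite ltnS.
  rewrite (bigD1 (Ordinal jN1, k))//= {1}/T /= nj.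
  apply: (@le_trans _ _ (Q N w * expR ((sr k).1 * \sum_(i < j) F k (X i w)))); last first.
    by rewrite lerDl sumr_ge0.
  rewrite ler_peMr// -[leLHS]expR0 ler_expR mulr_ge0//.
  by case: (Hsr k) => /ltW.
have intQ : (\int[P]_w (Q N w)%:E = 1)%E.
  rewrite (expectation_prod_iid X_iid N (f := fun=> phi))//; last by rewrite phi_int ltry.
  by rewrite big1.
rewrite -intQ.
apply: (@le_trans _ _ (\int[P]_w (D * \1_good w + \sum_p T p w)%:E)%E).
  apply: ge0_integral_EFin_le => //; apply: measurable_funD => //.
    by apply: measurable_funM => //; exact: measurable_indic.
  exact: measurable_sum.
rewrite ge0_integral_EFinD//; last 4 first.
- by apply: measurable_funM => //; exact: measurable_indic.
- exact: measurable_sum.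
- by move=> w; rewrite mulr_ge0.
- by move=> w; apply: sumr_ge0.
apply: leeD.
  rewrite ge0_integral_EFinZ//.
  by rewrite integral_indic// setIT.
under eq_integral do rewrite -sumEFin.
rewrite ge0_integral_sum//; last 2 first.
- by move=> p; exact/measurable_EFinP.
- by move=> p w _; rewrite lee_fin.
apply: (@le_trans _ _ (\sum_(p : 'I_N.+1 * I) (rho ^+ n)%:E)%E).
  by apply: lee_sum.
by rewrite sumEFin sumr_const card_prod card_ord lee_fin mulr_natl.
Qed.

End chernoff.

(** * Lower bound from a tilted density *)

(** This absorbs the number of steps in the union bound. *)
Lemma affine_geometric_small (R : realType) (rho : R) : 0 <= rho < 1 ->
  exists n0, forall n, (n0 <= n)%N -> (n * 12 + 20)%:R * rho ^+ n <= 2^-1.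
Proof.
move=> /andP[r0 r1].
pose r := Num.max rho 2^-1.
have rr : 0 < r by rewrite lt_max invr_gt0 ltr0n orbT.
have r1' : r < 1 by rewrite gt_max r1 /=; lra.
pose a := - ln r.
have a0 : 0 < a by rewrite oppr_gt0 ln_lt0// rr.
(* with rho ^+ n <= exp (- a n) and exp (a n) >= 1 + (a n)^2 / 2, it suffices
   that (a n)^2 / 2 >= 64 n >= 2 (12 n + 20) *)
exists (Num.truncn (128 / a ^+ 2)).+1 => n nn.
have n1 : 1 <= n%:R :> R by rewrite ler1n (leq_trans _ nn).
have na : 128 <= a ^+ 2 * n%:R.
  rewrite mulrC -ler_pdivrMr ?exprn_gt0//.
  have h : 0 <= 128 / a ^+ 2 by rewrite divr_ge0// sqr_ge0.
  have /andP[_ /ltW] := truncn_itv h.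
  by move=> /le_trans; apply; rewrite ler_nat.
have rn : rho ^+ n <= r ^+ n.
  by rewrite lerXn2r ?nnegrE ?(ltW rr)// le_max lexx.
apply: (@le_trans _ _ ((n * 12 + 20)%:R * r ^+ n)); first by rewrite ler_wpM2l.
have rE : r ^+ n = expR (- (a * n%:R)).
  by rewrite -mulNr opprK -(lnK rr) expRK mulrC -expRM_natl.
rewrite rE expRN ler_pdivrMr ?expR_gt0//.
have an0 : 0 <= a * n%:R by rewrite mulr_ge0// ltW.
have := expR_ge1Dxn 1 an0.
rewrite (_ : 2`!%:R = 2 :> R)// => H.
rewrite natrD natrM.
have : 128 * n%:R <= (a * n%:R) ^+ 2.
  by rewrite exprMn [n%:R ^+ 2]expr2 mulrA ler_wpM2r.
lra.
Qed.

Lemma steps_count_le (n N : nat) :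
  (N <= 3 * n.+1 + 1)%N -> (N.+1 * (2 * 2) <= n * 12 + 20)%N.
Proof. by move=> h; lia. Qed.

Lemma norm_le_of_signs (R : realDomainType) (x e : R) :
  x - e < 0 -> - x - e < 0 -> `|x| <= e.
Proof. by move=> h1 h2; rewrite ler_norml; apply/andP; split; lra. Qed.

(** The tolerance del is small enough for the speed of the walk, for the
    error on the velocity, and for the loss in the exponent, respectively. *)
Lemma small_tolerance (R : realType) (mu eps a b c c' : R) :
  0 < mu -> 0 < eps -> c < c' -> 0 <= a -> 0 <= b -> 0 <= c ->
  exists2 del, 0 < del & [/\ del <= mu / 2, del * (4 * (1 + a)) <= eps * mu &
    c * (mu + del) + b * del <= c' * (mu - del)].
Proof.
move=> mu0 e0 cc' a0 b0 c0.
have ka : 0 < 4 * (1 + a) by lra.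
have kb : 0 < c + b + c' by lra.
exists (Num.min (mu / 2) (Num.min (eps * mu / (4 * (1 + a)))
    ((c' - c) * mu / (c + b + c')))).
  by rewrite !lt_min !divr_gt0// mulr_gt0// subr_gt0.
set del := Num.min _ _.
have h1 : del <= mu / 2 by rewrite ge_min lexx.
have h2 : del * (4 * (1 + a)) <= eps * mu.
  by rewrite -ler_pdivlMr// /del !ge_min lexx orbT.
have h3 : del * (c + b + c') <= (c' - c) * mu.
  by rewrite -ler_pdivlMr// /del !ge_min lexx !orbT.
by split => //; lra.
Qed.

(** The window [n, N] contains the step at which a walk with speed between
    mu - del and mu + del crosses t. *)
Lemma renewal_window (R : realType) (mu del t : R) :
  0 < del -> del <= mu / 2 -> 0 < t ->
  exists n N : nat, [/\ n%:R * (mu + del) <= t, t < n.+1%:R * (mu + del),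
    t < N%:R * (mu - del), (N%:R - 1) * (mu - del) <= t &
    (0 < N)%N /\ (n <= N <= 3 * n.+1 + 1)%N].
Proof.
move=> del0 del1 t0.
have md0 : 0 < mu - del by lra.
have pd0 : 0 < mu + del by lra.
have /truncn_itv/andP[nle ltn] : 0 <= t / (mu + del) by rewrite divr_ge0// ltW.
have /truncn_itv/andP[Nle ltN] : 0 <= t / (mu - del) by rewrite divr_ge0// ltW.
set n := Num.truncn _ in nle ltn; set k := Num.truncn _ in Nle ltN.
rewrite ler_pdivlMr// in nle; rewrite ltr_pdivrMr// in ltn.
rewrite ltr_pdivrMr// in ltN; rewrite ler_pdivlMr// in Nle.
exists n, k.+1; split => //; first by rewrite -natr1 addrK.
split => //; apply/andP; split.
  rewrite -(ler_nat R) -(ler_pM2r md0); apply: le_trans (ltW ltN).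
  by apply: le_trans nle; rewrite ler_wpM2l//; lra.
rewrite addn1 ltnS -(ler_nat R) natrM -(ler_pM2r md0).
apply: (le_trans Nle); apply: (le_trans (ltW ltn)).
rewrite [3%:R * _]mulrC -mulrA ler_wpM2l//; lra.
Qed.

(** Both terms are of order del t, up to a bounded error that is absorbed for t
    large. *)
Lemma window_error_lt (R : realType) (mu del eps t a n N : R) :
  0 < del -> del <= mu / 2 -> del * (4 * (1 + a)) <= eps * mu -> 0 <= a ->
  0 < t -> 2 * (del + a * mu) < t * eps ->
  t < (n + 1) * (mu + del) -> 0 <= n -> (N - 1) * (mu - del) <= t -> 1 <= N ->
  del * N + a * (t - n * (mu - del)) < eps * t.
Proof.
move=> del0 del1 del2 a0 t0 h3 ltn n0 NR N1.
have mu0 : 0 < mu by lra.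
have h1 : N <= 2 * t / mu + 1.
  rewrite -lerBlDr ler_pdivlMr//.
  have : (N - 1) * (mu / 2) <= (N - 1) * (mu - del).
    by rewrite ler_wpM2l ?subr_ge0//; lra.
  lra.
have h2 : t - n * (mu - del) <= 2 * t * del / mu + mu.
  rewrite -lerBlDr ler_pdivlMr//.
  have : t * (mu - del) <= (n + 1) * (mu + del) * (mu - del).
    by rewrite ler_wpM2r ?(ltW ltn)//; lra.
  have : (t - n * (mu - del) - mu) * (mu + del) <= 2 * t * del by nra.
  have [pos|neg] := leP 0 (t - n * (mu - del) - mu).
    by have := mulr_ge0 pos (ltW del0); lra.
  have := mulr_ge0 (ltW t0) (ltW del0); have : (t - n * (mu - del) - mu) * mu <= 0.
    by rewrite mulr_le0_ge0// ltW.
  lra.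
have h4 : del * N <= del * (2 * t / mu + 1) by rewrite ler_pM2l.
have h5 : a * (t - n * (mu - del)) <= a * (2 * t * del / mu + mu) by rewrite ler_wpM2l.
apply: le_lt_trans (lerD h4 h5) _.
have -> : del * (2 * t / mu + 1) + a * (2 * t * del / mu + mu) =
  (del * (4 * (1 + a)) / mu) * t / 2 + (del + a * mu).
  by field; rewrite gt_eqF.
have h6 : del * (4 * (1 + a)) / mu <= eps by rewrite ler_pdivrMr.
have h7 : del * (4 * (1 + a)) / mu * t <= eps * t by rewrite ler_pM2r.
lra.
Qed.

Lemma expR_mass_lower_bound (R : realType) (k p e small : R) :
  1 <= expR k * p + small -> small <= 2^-1 -> e + k + 1 <= 0 -> expR e <= p.
Proof.
move=> H hs hk.
have half : 2^-1 <= expR k * p by lra.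
have h2 : expR (-1) <= 2^-1 :> R.
  rewrite expRN lef_pV2 ?posrE ?expR_gt0 ?ltr0n//.
  by have := expR_ge1Dx (1 : R); lra.
have h5 : expR e * expR k <= expR (-1) by rewrite -expRD ler_expR; lra.
have := le_trans h5 (le_trans h2 half).
by rewrite [X in _ <= X]mulrC ler_pM2r ?expR_gt0.
Qed.

Section lower_bound.
Context (R : realType) d (Omega : measurableType d) (P : probability Omega R).
Context (psi : probability (R * R)%type R).
Context (X : nat -> {RV P >-> (R * R)%type}).
Hypothesis psi_pos : psi (`]0, +oo[ `*` [set: R]) = 1%E.
Hypothesis X_iid : iid_with_law psi X.
Local Notation Z := (reward X).
Local Notation S := (renewal_time X).
Local Notation V := (reward_sum X).
Local Notation M := (renewal_count X).

(** If the walk (S_j, V_j) is close to its mean line for n <= j <= N, and if t is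
    reached between the steps n and N, then the last renewal before t happens in
    this window, and the reward at that moment is close to z t. *)
Lemma reward_near_line (w : Omega) (n N : nat) (mu del z t : R) :
  (forall i, 0 < (X i w).1) -> 0 <= del -> del <= mu -> 0 <= t -> (n <= N)%N ->
  n%:R * (mu + del) <= t -> t < N%:R * (mu - del) ->
  (forall j, (n <= j <= N)%N -> [/\ j%:R * (mu - del) <= S j w,
     S j w <= j%:R * (mu + del) & `|V j w - z * S j w| <= del * j%:R]) ->
  `|Z t w - z * t| <= del * N%:R + `|z| * (t - n%:R * (mu - del)).
Proof.
move=> wpos del0 delmu t0 nN nt tN H.
have /H[_ Sn _] : (n <= n <= N)%N by rewrite leqnn.
have /H[SN _ _] : (n <= N <= N)%N by rewrite nN leqnn.
have bw : renewals_bounded X t w.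
  exists N => k /= Sk; rewrite leEnat leqNgt; apply/negP => Nk.
  have := renewal_time_le wpos (ltnW Nk); lra.
have [H1 H2] := renewal_count_bounded t0 bw.
rewrite /reward -/(V (M t w) w).
set j := M t w in H1 H2 *.
have jN : (j <= N)%N.
  rewrite leqNgt; apply/negP => Nj.
  have := renewal_time_le wpos (ltnW Nj); lra.
have nj : (n <= j)%N by rewrite leqNgt; apply/negP => /H2; lra.
have /H[h1 h2 h3] : (n <= j <= N)%N by rewrite nj.
have -> : V j w - z * t = (V j w - z * S j w) - z * (t - S j w) by ring.
apply: le_trans (ler_normB _ _) _; apply: lerD.
  by apply: le_trans h3 _; rewrite ler_wpM2l// ler_nat.
rewrite normrM ler_wpM2l//.
rewrite ger0_norm ?subr_ge0// lerD2l lerN2.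
apply: le_trans h1; rewrite ler_wpM2r ?subr_ge0// ler_nat//.
Qed.

Variables (phi : R * R -> R) (s c y z : R).
Hypothesis mphi : measurable_fun setT phi.
Hypothesis phi0 : forall u, 0 <= phi u.
Hypothesis s0 : 0 < s.
Hypothesis phi_int : (\int[psi]_u (phi u)%:E = 1)%E.
Hypothesis phi_exp :
  (\int[psi]_u (phi u * expR (s * `|u.1| + s * `|u.2|))%:E < +oo)%E.
Hypothesis phi_mean0 : \int[psi]_u (phi u * (u.2 - z * u.1)) = 0.
Hypothesis c0 : 0 <= c.
Hypothesis phi_le : forall u, phi u <= expR (c * u.1 + y * (u.2 - z * u.1)).

Definition tilted_tau : R := \int[psi]_u (phi u * u.1).
Local Notation mu := tilted_tau.

Lemma norm_tau_le (u : R * R) : `|u.1| <= 1 * (1 + `|u.1| + `|u.2|).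
Proof. by rewrite mul1r; have := normr_ge0 u.1; have := normr_ge0 u.2; lra. Qed.

Lemma tilted_tau_gt0 : 0 < mu.
Proof.
have i1 := integrable_phiM mphi phi0 s0 phi_exp measurable_fst norm_tau_le ltr01.
rewrite -lte_fin -EFin_Rintegral//.
rewrite (@ae_eq_integral _ _ _ psi setT (fun z => (phi z * `|z.1|)%:E))//; last 3 first.
- by apply/measurable_EFinP; exact: measurable_funM.
- by apply/measurable_EFinP; apply: measurable_funM => //; exact: measurableT_comp.
- by apply: filterS (ae_tau_gt0 psi_pos) => u u0 _; rewrite gtr0_norm.
rewrite lt0e integral_ge0 ?andbT; last first.
  by move=> u _; rewrite lee_fin mulr_ge0.
apply/eqP => int0.
have [/(_ _)/wrap[|H _]] := @ae_eq_integral_abs _ _ _ psi setT measurableT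
  (fun u => (phi u * `|u.1|)%:E) (proj2 (measurable_EFinP _ _)
   (measurable_funM mphi (measurableT_comp (@normr_measurable R setT) measurable_fst))).
  by under eq_integral do rewrite /= ger0_norm ?mulr_ge0//.
have : (\int[psi]_u (phi u)%:E = \int[psi]_u 0)%E.
  apply: ae_eq_integral => //; first exact/measurable_EFinP.
  apply: filterS2 (ae_tau_gt0 psi_pos) H => u u0 /(_ I)/= [H] _.
  move/eqP: H; rewrite mulf_eq0 normr_eq0 (gt_eqF u0) orbF => /eqP ->.
  by [].
by rewrite phi_int integral0 => /eqP; rewrite eqe oner_eq0.
Qed.

(** The four one-sided deviations, by more than del per step, of S_j from its
    mean and of V_j from z S_j, indexed by the quantity and the sign. *)
Definition deviation (del : R) (b : bool * bool) (u : R * R) : R :=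
  (-1) ^+ b.2 * (if b.1 then u.1 - mu else u.2 - z * u.1) - del.

Local Notation dev := deviation.

Lemma measurable_deviation del b : measurable_fun setT (dev del b).
Proof.
apply: measurable_funB => //; apply: measurable_funM => //.
case: b.1; first exact: measurable_funB.
by apply: measurable_funB => //; exact: measurable_funM.
Qed.

Lemma deviation_bound del b u : 0 <= del ->
  `|dev del b u| <= (1 + `|mu| + `|z| + del) * (1 + `|u.1| + `|u.2|).
Proof.
move=> del0; apply: le_trans (ler_normB _ _) _.
rewrite normrM normrX normrN1 expr1n mul1r (ger0_norm del0).
have p0 := normr_ge0 u.1; have q0 := normr_ge0 u.2.
have m0 := normr_ge0 mu; have z0 := normr_ge0 z.
have h : `|if b.1 then u.1 - mu else u.2 - z * u.1| <=
   `|u.1| + `|u.2| + `|mu| + `|z| * `|u.1|.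
  case: b.1.
    apply: le_trans (ler_normB _ _) _.
    by have := mulr_ge0 z0 p0; lra.
  apply: le_trans (ler_normB _ _) _.
  by rewrite normrM; lra.
have := mulr_ge0 m0 p0; have := mulr_ge0 m0 q0; have := mulr_ge0 z0 q0.
have := mulr_ge0 del0 p0; have := mulr_ge0 del0 q0; lra.
Qed.

Lemma deviation_mean del b : \int[psi]_u (phi u * dev del b u) = - del.
Proof.
have i1 := integrable_phiM mphi phi0 s0 phi_exp measurable_fst norm_tau_le ltr01.
have i0 := integrable_phi mphi phi0 phi_int.
have m2 : measurable_fun setT (fun u : R * R => u.2 - z * u.1).
  by apply: measurable_funB => //; exact: measurable_funM.
have b2 (u : R * R) : `|u.2 - z * u.1| <= (1 + `|z|) * (1 + `|u.1| + `|u.2|).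
  apply: le_trans (ler_normB _ _) _; rewrite normrM.
  have p0 := normr_ge0 u.1; have q0 := normr_ge0 u.2; have z0 := normr_ge0 z.
  by have := mulr_ge0 z0 q0; lra.
have z1 : 0 < 1 + `|z| by rewrite ltr_pwDl.
have i2 := integrable_phiM mphi phi0 s0 phi_exp m2 b2 z1.
have ephi : \int[psi]_u phi u = 1 by rewrite /Rintegral phi_int.
have [e | e] : b.1 = true \/ b.1 = false by case: b.1; [left|right].
  have [_ E] := integrable_lin ((-1) ^+ b.2) ((-1) ^+ b.2 * (- mu) - del) i1 i0.
  transitivity (\int[psi]_x ((-1) ^+ b.2 * (phi x * x.1) + ((-1) ^+ b.2 * - mu - del) * phi x)).
    by apply: eq_Rintegral => u _; rewrite /dev e; ring.
  by rewrite E ephi -/mu; ring.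
have [_ E] := integrable_lin ((-1) ^+ b.2) (- del) i2 i0.
transitivity (\int[psi]_x ((-1) ^+ b.2 * (phi x * (x.2 - z * x.1)) + (- del) * phi x)).
  by apply: eq_Rintegral => u _; rewrite /dev e; ring.
by rewrite E ephi phi_mean0; ring.
Qed.


(** The exponent loses only c (mu + del) + |y| del per step, over about
    t / (mu - del) steps; as del goes to 0 this is c t. *)
Lemma prob_near_ge_of_density (eps c' : R) : 0 < eps -> c < c' ->
  exists2 t0, 0 < t0 & forall t, t0 < t ->
    ((expR (- c' * t))%:E <= P [set w | (`|Z t w / t - z| < eps)%R])%E.
Proof.
move=> e0 cc'.
(* tau is an opaque copy of the mean, which keeps the arithmetic below atomic *)
have [tau tauE] : exists r, r = mu by exists mu.
have tau0 : 0 < tau by rewrite tauE; exact: tilted_tau_gt0.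
pose c2 := (c + c') / 2.
have cc2 : c < c2 by rewrite /c2; lra.
have c2c' : c2 < c' by rewrite /c2; lra.
have c20 : 0 <= c2 by rewrite ltW// (le_lt_trans c0).
have [del del0 [del1 del2]] :=
  small_tolerance tau0 e0 cc2 (normr_ge0 z) (normr_ge0 y) c0.
set kap := c * _ + _ => kap2.
have B0 : 0 < 1 + `|mu| + `|z| + del.
  by rewrite ltr_wpDl// !addr_ge0.
have dmean b : \int[psi]_u (phi u * dev del b u) < 0.
  by rewrite deviation_mean oppr_lt0.
have [rho rho01 Hrho] := tilted_event_bound mphi phi0 s0 phi_int phi_exp X_iid B0
  (measurable_deviation del) (fun b u => deviation_bound b u (ltW del0)) dmean.
have [n0 Hn0] := affine_geometric_small rho01.
(* t large, so that n >= n0, so that the bounded error on the velocity is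
   absorbed, and so that the constant exp (kap + 1) is *)
exists (Num.max 1 (Num.max ((tau + del) * n0.+1%:R)
  (Num.max (2 * (del + `|z| * tau) / eps) ((kap + 1) / (c' - c2))))).
  by rewrite lt_max ltr01.
move=> t; rewrite !gt_max => /and4P[t_1 t1t t2t t3t].
have t0 : 0 < t by rewrite (lt_trans ltr01).
have [n [N [nt tn tN Nt [Npos /andP[nN Nn]]]]] := renewal_window del0 del1 t0.
have pd0 : 0 < tau + del by rewrite addr_gt0.
have n0n : (n0 <= n)%N.
  rewrite -ltnS -(ltr_nat R) -(ltr_pM2r pd0); apply: le_lt_trans tn.
  by apply: le_trans (ltW t1t); rewrite mulrC ler_pM2l// ler_nat.
pose good := [set w | forall j b, (n <= j <= N)%N -> \sum_(i < j) dev del b (X i w) < 0].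
have goodP w : good w -> forall j, (n <= j <= N)%N -> [/\ j%:R * (tau - del) <= S j w,
     S j w <= j%:R * (tau + del) & `|V j w - z * S j w| <= del * j%:R].
  move=> gw j nj.
  have sum1 sg : \sum_(i < j) ((-1) ^+ sg * ((X i w).1 - tau) - del) =
      (-1) ^+ sg * (S j w - j%:R * tau) - j%:R * del.
    rewrite big_split/= -mulr_sumr sumrN sumr_const card_ord big_split/= sumrN.
    by rewrite sumr_const card_ord !mulr_natl.
  have sum2 sg : \sum_(i < j) ((-1) ^+ sg * ((X i w).2 - z * (X i w).1) - del) =
      (-1) ^+ sg * (V j w - z * S j w) - j%:R * del.
    rewrite big_split/= -mulr_sumr sumrN sumr_const card_ord big_split/= sumrN.
    by rewrite -mulr_sumr !mulr_natl.
  have := gw j (true, false) nj; rewrite /deviation/= -tauE sum1 expr0 mul1r => h1.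
  have := gw j (true, true) nj; rewrite /deviation/= -tauE sum1 expr1 mulN1r => h2.
  have := gw j (false, false) nj; rewrite /deviation/= sum2 expr0 mul1r => h3.
  have := gw j (false, true) nj; rewrite /deviation/= sum2 expr1 mulN1r => h4.
  have := norm_le_of_signs h1 h2; rewrite ler_distl => /andP[l1 l2].
  split; [by rewrite mulrBr|by rewrite mulrDr|].
  by rewrite [del * _]mulrC; exact: norm_le_of_signs h3 h4.
have gD w : good w -> \prod_(i < N) phi (X i w) <= expR (N%:R * kap).
  move=> gw; have /(goodP w gw)[_ SN VN] : (n <= N <= N)%N by rewrite nN leqnn.
  apply: (@le_trans _ _ (\prod_(i < N)
      expR (c * (X i w).1 + y * ((X i w).2 - z * (X i w).1)))).
    by apply: ler_prod => i _; rewrite phi0 phi_le.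
  rewrite -expR_sum ler_expR big_split/= -!mulr_sumr.
  rewrite [X in _ + y * X]big_split/= sumrN -mulr_sumr.
  rewrite -/(S N w) -/(V N w) /kap [leRHS]mulrDr; apply: lerD.
    by apply: le_trans (ler_wpM2l c0 SN) _; rewrite mulrCA.
  apply: le_trans (ler_norm _) _; rewrite normrM.
  by apply: le_trans (ler_wpM2l (normr_ge0 y) VN) _; rewrite [leLHS]mulrA [leLHS]mulrC.
have [mgood Hgood] := Hrho n N (expR (N%:R * kap)) (expR_ge0 _) gD.
have Pfin : P good \is a fin_num by exact: fin_num_measure.
apply: (@le_trans _ _ (P good)).
  rewrite -(fineK Pfin) lee_fin.
  apply: (@expR_mass_lower_bound _ (N%:R * kap) _ _
      ((N.+1 * #|{: bool * bool}|)%:R * rho ^+ n)).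
  - by move: Hgood; rewrite -(fineK Pfin) -EFinM -EFinD lee_fin.
  - apply: le_trans (Hn0 n n0n); rewrite ler_wpM2r ?exprn_ge0//.
      by case/andP: rho01.
    by rewrite card_prod card_bool ler_nat; exact: steps_count_le.
  have h3 : kap + 1 <= (c' - c2) * t.
    by rewrite mulrC -ler_pdivrMr ?subr_gt0// ltW.
  have N1 : (0 : R) <= N%:R - 1 by rewrite subr_ge0 ler1n.
  have h4 : (N%:R - 1) * kap <= c2 * t.
    by apply: le_trans (ler_wpM2l N1 kap2) _; rewrite mulrCA ler_wpM2l.
  lra.
have [N0 [mN0 PN0 NP]] := ae_all_tau_gt0 psi_pos X_iid.
have mE := measurable_velocity_near X t z eps.
apply: (@le_trans _ _ (P ([set w | `|Z t w / t - z| < eps]%R `|` N0))); last first.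
  apply: le_trans (measureU2 _ mE mN0) _.
  by rewrite [X in (_ + X)%E]PN0 adde0.
apply: le_measure; rewrite ?inE//; first exact: measurableU.
move=> w gw; have [wpos|wneg] := pselect (forall i, 0 < (X i w).1); last first.
  by right; apply: NP.
left => /=.
have dmu : del <= tau by rewrite (le_trans del1)// ler_piMr ?(ltW tau0)// invf_le1 ?ler1n.
have := reward_near_line wpos (ltW del0) dmu (ltW t0) nN nt tN (goodP w gw).
have -> : Z t w / t - z = (Z t w - z * t) / t by field; rewrite gt_eqF.
rewrite normrM normfV (gtr0_norm t0) ltr_pdivrMr// => /le_lt_trans; apply.
apply: window_error_lt => //.
- by rewrite -ltr_pdivrMr.
- by rewrite natr1.
- by rewrite ler1n.
Qed.

End lower_bound.

(** * Truncated exponential tilts *)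

Section truncated_tilt.
Context (R : realType) (psi : probability (R * R)%type R).
Variables (c z : R).
Hypothesis c0 : 0 <= c.

Definition box (K : nat) : set (R * R) := [set u | `|u.1| <= K%:R /\ `|u.2| <= K%:R].
Definition tilt_var (u : R * R) : R := u.2 - z * u.1.
Definition weight (K : nat) (y : R) (u : R * R) : R :=
  \1_(box K) u * expR (c * u.1 + y * tilt_var u).
(** The function y |-> E exp (c tau + y (W - z tau)) truncated to a box, which
    is finite and continuous for every law. *)
Definition box_mass (K : nat) (y : R) : R := \int[psi]_u weight K y u.
Definition box_width (K : nat) : R := (1 + `|z|) * K%:R.
Local Notation A := box.
Local Notation U := tilt_var.
Local Notation wt := weight.
Local Notation g := box_mass.
Local Notation b := box_width.

Lemma measurable_box K : measurable (A K).
Proof.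
rewrite (_ : A K = `[- K%:R, K%:R] `*` `[- K%:R, K%:R]).
  by apply: measurableX; exact: measurable_itv.
by apply/seteqP; split => u; rewrite /A /= !in_itv/= !ler_norml.
Qed.

Lemma box_le K L u : (K <= L)%N -> A K u -> A L u.
Proof.
rewrite -(ler_nat R) => KL [h1 h2]; split; [exact: le_trans KL|exact: le_trans KL].
Qed.

Lemma measurable_tilt_var : measurable_fun setT U.
Proof. by apply: measurable_funB => //; exact: measurable_funM. Qed.

Lemma measurable_weight K y : measurable_fun setT (wt K y).
Proof.
apply: measurable_funM; first exact: measurable_indic (measurable_box K).
apply: measurableT_comp => //; apply: measurable_funD; first exact: measurable_funM.
by apply: measurable_funM => //; exact: measurable_tilt_var.
Qed.

Lemma weight_ge0 K y u : 0 <= wt K y u.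
Proof. by rewrite mulr_ge0 ?expR_ge0. Qed.

Lemma tilt_var_box K u : A K u -> `|U u| <= b K.
Proof.
move=> [h1 h2]; apply: le_trans (ler_normB _ _) _; rewrite normrM /b mulrDl mul1r.
by apply: lerD => //; rewrite ler_wpM2l.
Qed.

Lemma weight_bounded K y u : wt K y u <= expR (c * K%:R + `|y| * b K).
Proof.
rewrite /wt indicE; case: (boolP (u \in A K)) => [/set_mem uA|_]; last first.
  by rewrite mul0r expR_ge0.
rewrite mul1r ler_expR; apply: lerD.
  by rewrite ler_wpM2l// (le_trans (ler_norm _))//; case: uA.
apply: le_trans (ler_norm _) _; rewrite normrM ler_wpM2l//.
exact: tilt_var_box.
Qed.

Lemma integrable_weight K y : psi.-integrable setT (EFin \o wt K y).
Proof.
apply: ge0_fin_integrable; [exact: measurable_weight|exact: weight_ge0|].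
apply: (@le_lt_trans _ _ (\int[psi]_u (expR (c * K%:R + `|y| * b K))%:E)%E); last first.
  by rewrite EFin_Rintegral ?ltry//; exact: finite_measure_integrable_cst.
apply: ge0_integral_EFin_le => //.
- exact: measurable_weight.
- exact: weight_ge0.
- by move=> u; exact: weight_bounded.
Qed.

Lemma box_mass_shift K y y' : g K y' <= g K y * expR (b K * `|y' - y|).
Proof.
rewrite /g mulrC -RintegralZl//; last exact: integrable_weight.
apply: le_Rintegral => //.
- exact: integrable_weight.
- exact: (@integrableZl _ _ _ psi setT measurableT _ _ (integrable_weight K y)).
move=> u _; rewrite /wt indicE; case: (boolP (u \in A K)) => [/set_mem uA|_]; last first.
  by rewrite !mul0r mulr0.
rewrite !mul1r -expRD ler_expR.
have := tilt_var_box uA; set Uu := U u => hU.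
have : (y' - y) * Uu <= b K * `|y' - y|.
  apply: le_trans (ler_norm _) _; rewrite normrM mulrC.
  by rewrite ler_wpM2r.
lra.
Qed.

Lemma box_mass_ge0 K y : 0 <= g K y.
Proof. by apply: Rintegral_ge0 => u _; exact: weight_ge0. Qed.

Lemma box_mass_continuous K : continuous (g K).
Proof.
move=> y.
have cts (k : R) : (fun y' => g K y * expR (k * `|y' - y|)) @ y --> g K y.
  rewrite -[X in _ --> X]mulr1 -(expR0 R) -(mulr0 k) -(normr0 R) -(subrr y).
  apply: cvgMr; apply: (cvg_comp _ expR); last exact: continuous_expR.
  apply: cvgMr; apply: cvg_norm; apply: cvgB; [exact: cvg_id|exact: cvg_cst].
apply: (squeeze_cvgr _ (cts (- b K)) (cts (b K))).
apply: nearW => y'; rewrite box_mass_shift andbT.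
rewrite mulNr expRN ler_pdivrMr ?expR_gt0// distrC.
exact: box_mass_shift.
Qed.

Lemma box_mass_mono K L y : (K <= L)%N -> g K y <= g L y.
Proof.
move=> KL; apply: le_Rintegral => //; try exact: integrable_weight.
move=> u _; rewrite /wt ler_wpM2r ?expR_ge0// !indicE ler_nat.
case: (boolP (u \in A K)) => [/set_mem uA|_] //.
by rewrite mem_set//; exact: box_le uA.
Qed.

Lemma integrable_weight_tilt_var K y :
  psi.-integrable setT (EFin \o (fun u => wt K y u * U u)).
Proof.
have bK : 0 <= b K by rewrite mulr_ge0// addr_ge0.
have Hi := @integrableZl _ _ _ psi setT measurableT (b K) _ (integrable_weight K y).
apply: le_integrable Hi => //.
  apply/measurable_EFinP/measurable_funM; [exact: measurable_weight|exact: measurable_tilt_var].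
move=> u _; rewrite /= lee_fin normrM (ger0_norm (weight_ge0 _ _ _)) [leRHS]ger0_norm; last first.
  by rewrite mulr_ge0// weight_ge0.
rewrite /wt indicE; case: (boolP (u \in A K)) => [/set_mem uA|_]; last first.
  by rewrite !mul0r mulr0.
rewrite mulrC ler_wpM2r ?mul1r ?expR_ge0//; exact: tilt_var_box.
Qed.

(** The first-order condition at the minimum over y, obtained from a quadratic
    upper bound of the increments. *)
Lemma minimizer_mean0 K y : (forall y', g K y <= g K y') ->
  \int[psi]_u (wt K y u * U u) = 0.
Proof.
move=> ymin; set a := \int[psi]_u _.
have bK : 0 <= b K by rewrite mulr_ge0// addr_ge0.
pose C := (b K) ^+ 2 * expR (b K) * g K y.
have C0 : 0 <= C by rewrite !mulr_ge0 ?sqr_ge0 ?expR_ge0// box_mass_ge0.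
have iwU := integrable_weight_tilt_var K y.
have key h : `|h| <= 1 -> 0 <= h * a + h ^+ 2 * C.
  move=> h1.
  have [i2 E2] := integrable_lin h ((b K) ^+ 2 * expR (b K) * h ^+ 2) iwU (integrable_weight K y).
  have [i3 E3] := integrable_lin 1 1 i2 (integrable_weight K y).
  have : g K (y + h) <= \int[psi]_x (1 * (h * (wt K y x * U x) +
      (b K) ^+ 2 * expR (b K) * h ^+ 2 * wt K y x) + 1 * wt K y x).
    apply: le_Rintegral => //; first exact: integrable_weight.
    move=> u _; rewrite !mul1r /wt indicE.
    case: (boolP (u \in A K)) => [/set_mem uA|_]; last by rewrite !mul0r !mulr0 !addr0.
    rewrite !mul1r; set e := expR (c * u.1 + y * U u).
    have -> : expR (c * u.1 + (y + h) * U u) = e * expR (h * U u).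
      by rewrite /e -expRD; congr expR; ring.
    have hU := tilt_var_box uA.
    have hb : `|h * U u| <= b K.
      by rewrite normrM -[leRHS]mul1r; apply: ler_pM.
    have := expR_le_quadratic (h * U u).
    have : (h * U u) ^+ 2 * expR `|h * U u| <= h ^+ 2 * (b K) ^+ 2 * expR (b K).
      apply: ler_pM; rewrite ?sqr_ge0 ?expR_ge0 ?ler_expR//.
      rewrite exprMn ler_wpM2l ?sqr_ge0//.
      by rewrite -[leLHS]real_normK ?num_real// lerXn2r// nnegrE.
    move=> q1 q2.
    have e0 : 0 <= e by exact: expR_ge0.
    have := ler_wpM2l e0 (le_trans q2 (lerD (lexx _) q1)).
    lra.
  rewrite E3 E2 !mul1r -/a -/(g K y) => h2.
  have := ymin (y + h); rewrite /C; lra.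
apply/eqP; rewrite -sqrf_eq0 -normr_le0 ger0_norm ?sqr_ge0// leNgt; apply/negP => a0.
have na : 0 < `|a| + 1 by rewrite ltr_wpDl.
have nC : 0 < 2 * (C + 1) by rewrite mulr_gt0// ltr_wpDl.
(* the increment h = - t a satisfies |h| <= 1 and makes h a + h^2 C negative *)
pose t := Num.min (`|a| + 1)^-1 (2 * (C + 1))^-1.
have t0 : 0 < t by rewrite lt_min !invr_gt0 na.
have t1 : t * (`|a| + 1) <= 1.
  by rewrite -ler_pdivlMr// mul1r /t ge_min lexx.
have t2 : t * (2 * (C + 1)) <= 1.
  by rewrite -ler_pdivlMr// mul1r /t ge_min lexx orbT.
have := key (- (t * a)).
rewrite normrN normrM gtr0_norm// => /(_ _)/wrap[|]; first by lra.
have -> : - (t * a) * a + (- (t * a)) ^+ 2 * C = - (t * a ^+ 2) * (1 - t * C) by ring.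
by apply/negP; rewrite -ltNge nmulr_rlt0; [lra|rewrite oppr_lt0 mulr_gt0].
Qed.

End truncated_tilt.

(** * Existence of a centred truncated tilt *)

Section tilt_existence.
Context (R : realType) (psi : probability (R * R)%type R).

Lemma box_cover (u : R * R) : exists K, forall L, (K <= L)%N -> box L u.
Proof.
exists (Num.truncn (`|u.1| + `|u.2|)).+1 => L KL.
have n0 : 0 <= `|u.1| + `|u.2| by rewrite addr_ge0.
have /truncn_itv/andP[_ /ltW H] := n0.
have {}H : `|u.1| + `|u.2| <= L%:R by apply: le_trans H _; rewrite ler_nat.
by split; apply: le_trans H; rewrite ?lerDl ?lerDr.
Qed.

(** The sets where V is at least 1 / (n + 1), inside the box of size n, exhaust the
    set where V is positive. *)
Lemma positive_part_mass (V : R * R -> R) : measurable_fun setT V ->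
  ~ {ae psi, forall u, V u <= 0} -> exists K del, 0 < del /\
    (0 < psi (box K `&` [set u | (del <= V u)%R]))%E.
Proof.
move=> mV nV; apply: contrapT => H; apply: nV.
pose B n := box n `&` [set u | n.+1%:R^-1 <= V u].
have mB n : measurable (B n).
  apply: measurableI; first exact: measurable_box.
  rewrite (_ : [set u | _] = V @^-1` `[n.+1%:R^-1, +oo[).
    by rewrite -[_ @^-1` _]setTI; exact: mV.
  by apply/seteqP; split => u /=; rewrite in_itv/= andbT.
have nB : psi.-negligible (\bigcup_n B n).
  apply: negligible_bigcup => n; exists (B n); split => //.
  apply/eqP; rewrite eq_le measure_ge0 andbT leNgt; apply/negP => Bn0.
  by apply: H; exists n, n.+1%:R^-1; split; [rewrite invr_gt0 ltr0n|exact: Bn0].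
apply: negligibleS nB => u /= /negP; rewrite -ltNge => Vu.
have [K HK] := box_cover u.
pose L := maxn K (Num.truncn (V u)^-1).
exists L => //; split; first by apply: HK; exact: leq_maxl.
rewrite /= -[leRHS]invrK lef_pV2 ?posrE ?invr_gt0 ?ltr0n//.
have /truncn_itv/andP[_ /ltW h] : 0 <= (V u)^-1 by rewrite invr_ge0 ltW.
by apply: le_trans h _; rewrite ler_nat ltnS leq_maxr.
Qed.

Variables (c z : R).
Hypothesis c0 : 0 <= c.

(** A positive mass on which sg (W - z tau) is bounded below by del > 0 makes the function
    grow in the direction sg, uniformly in the box; a linear minorant is
    enough. *)
Lemma box_mass_coercive (sg : R) : sg ^+ 2 = 1 ->
  ~ {ae psi, forall u, sg * tilt_var z u <= 0} ->
  exists K p del, [/\ 0 < p, 0 < del &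
    forall L k, (K <= L)%N -> 0 <= k -> p * (1 + del * k) <= box_mass psi c z L (sg * k)].
Proof.
move=> sg2 nae.
have mV : measurable_fun setT (fun u : R * R => sg * tilt_var z u).
  by apply: measurable_funM => //; exact: measurable_tilt_var.
have [K [del [del0]]] := positive_part_mass mV nae.
set B := _ `&` _ => B0.
have mB : measurable B.
  apply: measurableI; first exact: measurable_box.
  rewrite (_ : [set u | _] = (fun u => sg * tilt_var z u) @^-1` `[del, +oo[).
    by rewrite -[_ @^-1` _]setTI; exact: mV.
  by apply/seteqP; split => u /=; rewrite in_itv/= andbT.
have Bfin : psi B \is a fin_num by exact: fin_num_measure.
exists K, (expR (- (c * K%:R)) * fine (psi B)), del; split => //.
  by rewrite mulr_gt0 ?expR_gt0// -lte_fin fineK.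
move=> L k KL k0.
apply: (@le_trans _ _ (expR (- (c * K%:R)) * fine (psi B) * expR (del * k))).
  by rewrite ler_wpM2l ?expR_ge1Dx// mulr_ge0 ?expR_ge0// fine_ge0.
apply: le_trans (box_mass_mono psi z c0 _ KL).
have iB : psi.-integrable setT (EFin \o (fun u => expR (- (c * K%:R) + del * k) * \1_B u)).
  apply: ge0_fin_integrable.
  - by apply: measurable_funM => //; exact: measurable_indic.
  - by move=> u; rewrite mulr_ge0 ?expR_ge0.
  rewrite ge0_integral_EFinZ ?expR_ge0//.
  rewrite integral_indic// setIT; apply: lte_mul_pinfty => //.
  exact: le_lt_trans (probability_le1 psi mB) (ltry 1).
have -> : expR (- (c * K%:R)) * fine (psi B) * expR (del * k) =
    \int[psi]_u (expR (- (c * K%:R) + del * k) * \1_B u).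
  rewrite /Rintegral ge0_integral_EFinZ ?expR_ge0//.
  by rewrite integral_indic// setIT fineM//= expRD; ring.
apply: le_Rintegral => //; first exact: integrable_weight.
move=> u _; rewrite /weight !indicE.
case: (boolP (u \in B)) => [/set_mem uB|_]; last first.
  by rewrite mulr0 mulr_ge0 ?expR_ge0.
have [uK /= uV] := uB; rewrite mem_set// mulr1 mul1r ler_expR.
apply: lerD.
  rewrite -mulrN ler_wpM2l// lerNl; case: uK => h _.
  by apply: le_trans h; rewrite -normrN ler_norm.
by rewrite mulrAC mulrC [leRHS]mulrC ler_wpM2l.
Qed.

(** Monotone convergence as the box grows. *)
Lemma box_mass_gt1 y : (1 < mgf psi (c - z * y) y)%E ->
  exists K, forall L, (K <= L)%N -> 1 < box_mass psi c z L y.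
Proof.
move=> mgf1; apply: contrapT => H.
have le1 K : box_mass psi c z K y <= 1.
  rewrite leNgt; apply/negP => K1; apply: H; exists K => L KL.
  by apply: lt_le_trans K1 _; exact: box_mass_mono.
have := @cvg_monotone_convergence _ _ _ psi setT measurableT
  (fun K u => (weight c z K y u)%:E) _ _ _.
have -> : (fun u => limn (fun K => (weight c z K y u)%:E)) =
    (fun u => (expR ((c - z * y) * u.1 + y * u.2))%:E).
  apply/funext => u; apply/cvg_lim => //.
  have [K HK] := box_cover u.
  apply: cvg_near_cst; exists K => // L /= KL.
  rewrite /weight indicE mem_set ?mul1r; last exact: HK.
  by congr (expR _)%:E; rewrite /tilt_var; ring.
move=> cv.
have {}cv : (\int[psi]_u (weight c z K y u)%:E)%E @[K --> \oo] --> mgf psi (c - z * y) y.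
  apply: cv.
  - by move=> K; apply/measurable_EFinP; exact: measurable_weight.
  - by move=> K u _; rewrite lee_fin weight_ge0.
  - move=> u _ K L KL; rewrite lee_fin /weight ler_wpM2r ?expR_ge0// !indicE ler_nat.
    case: (boolP (u \in box K)) => [/set_mem uA|_] //.
    by rewrite mem_set//; exact: box_le uA.
have := cvg_lim (@ereal_hausdorff R) cv => E.
have : (limn (fun K => \int[psi]_u (weight c z K y u)%:E) <= 1)%E.
  apply: lime_le; first by apply/cvg_ex; eexists; exact: cv.
  apply: nearW => K; rewrite EFin_Rintegral ?lee_fin; first exact: le1.
  exact: integrable_weight.
by rewrite E leNgt mgf1.
Qed.

Hypothesis mgf_gt1 : forall y, (1 < mgf psi (c - z * y) y)%E.
Hypothesis both_signs : forall sg : R, sg ^+ 2 = 1 ->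
  ~ {ae psi, forall u, sg * tilt_var z u <= 0}.

(** Coercivity reduces the condition that the truncated function exceeds 1
    everywhere to a compact interval of values of y. There, one box works near
    each point by continuity, hence one box works for all. In this box the
    minimum over y exists. *)
Lemma box_mass_minimizer : exists K y, 1 < box_mass psi c z K y /\
  forall y', box_mass psi c z K y <= box_mass psi c z K y'.
Proof.
have sqN1 : (-1) ^+ 2 = 1 :> R by rewrite sqrrN expr1n.
have [K1 [p1 [d1 [p10 d10 H1]]]] := box_mass_coercive (expr1n _ 2) (both_signs (expr1n _ 2)).
have [K2 [p2 [d2 [p20 d20 H2]]]] := box_mass_coercive sqN1 (both_signs sqN1).
have big (a : R) : 0 <= a -> exists2 Y, 0 < Y & forall L y, (maxn K1 K2 <= L)%N -> Y <= `|y| ->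
    a < box_mass psi c z L y.
  move=> a0; exists (a / (p1 * d1) + a / (p2 * d2) + 1).
    by rewrite ltr_wpDl// addr_ge0// divr_ge0// mulr_ge0// ltW.
  move=> L y; rewrite geq_max => /andP[L1 L2] Yy.
  have q1 : 0 <= a / (p1 * d1) by rewrite divr_ge0// mulr_ge0// ltW.
  have q2 : 0 <= a / (p2 * d2) by rewrite divr_ge0// mulr_ge0// ltW.
  have y0 := normr_ge0 y.
  have [ypos|yneg] := leP 0 y.
    have := H1 L `|y| L1 y0; rewrite mul1r (ger0_norm ypos) => /(lt_le_trans _); apply.
    have : a / (p1 * d1) < y by rewrite ger0_norm// in Yy; lra.
    by rewrite ltr_pdivrMr ?mulr_gt0//; lra.
  have := H2 L `|y| L2 y0; rewrite mulN1r (ltr0_norm yneg) opprK => /(lt_le_trans _); apply.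
  have : a / (p2 * d2) < - y by rewrite ltr0_norm// in Yy; lra.
  by rewrite ltr_pdivrMr ?mulr_gt0//; lra.
have [Y Y0 HY] := big 1 ler01.
have cov : near_covering `[- Y, Y] by apply/compact_near_coveringP; exact: segment_compact.
have [K _ HK] : \forall K \near \oo, `[- Y, Y] `<=` [set y | 1 < box_mass psi c z K y].
  apply: cov => y _.
  have [K HK] := box_mass_gt1 (mgf_gt1 y).
  have gK := HK K (leqnn K).
  have cg := @box_mass_continuous R psi c z c0 K y.
  have near_y : \forall y' \near y, 1 < box_mass psi c z K y'.
    exact: (cvgr_gt _ cg _ gK).
  (* continuity for the box K, monotonicity for the larger boxes *)
  exists ([set y' | 1 < box_mass psi c z K y'], [set L | (K <= L)%N]).
    by split => //; exists K.
  move=> [y' L] [/= h1 h2]; apply: lt_le_trans h1 _; exact: box_mass_mono.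
pose L := maxn K (maxn K1 K2).
have KL : (K <= L)%N by rewrite leq_maxl.
have KL' : (maxn K1 K2 <= L)%N by rewrite leq_maxr.
have gt1 y : 1 < box_mass psi c z L y.
  have [yY|yY] := leP Y `|y|; first exact: HY.
  by apply: (HK L KL); rewrite /= in_itv/= -ler_norml ltW.
have [Y' Y'0 HY'] := big _ (box_mass_ge0 psi c z L 0).
have [y yin ymin] : exists2 y, y \in `[- Y', Y'] &
    forall y', y' \in `[- Y', Y'] -> box_mass psi c z L y <= box_mass psi c z L y'.
  apply: EVT_min; first lra.
  apply: continuous_subspaceT; exact: box_mass_continuous.
exists L, y; split => // y'.
have [y'Y|y'Y] := leP `|y'| Y'.
  by apply: ymin; rewrite in_itv/= -ler_norml.
apply: le_trans (ltW (HY' L y' KL' (ltW y'Y))).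
apply: ymin; rewrite in_itv/=; apply/andP; split; lra.
Qed.

Hypothesis psi_pos : psi (`]0, +oo[ `*` [set: R]) = 1%E.
Context d (Omega : measurableType d) (P : probability Omega R).
Context (X : nat -> {RV P >-> (R * R)%type}).
Hypothesis X_iid : iid_with_law psi X.

(** The density is the truncated weight divided by its mass. As this mass
    exceeds 1, the density is at most exp (c tau + y (W - z tau)). *)
Lemma prob_near_ge_of_tilt (eps c' : R) : 0 < eps -> c < c' ->
  exists2 t0, 0 < t0 & forall t, t0 < t ->
    ((expR (- c' * t))%:E <= P [set w | (`|reward X t w / t - z| < eps)%R])%E.
Proof.
have [K [y [g1 ymin]]] := box_mass_minimizer.
set g := box_mass psi c z K y in g1 ymin.
have g0 : 0 < g by rewrite (lt_trans ltr01).
pose phi u := g^-1 * weight c z K y u.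
have iw := @integrable_weight R psi c z c0 K y.
have mw := measurable_weight c z K y.
have w0 := weight_ge0 c z K y.
have gE : (\int[psi]_u (weight c z K y u)%:E = g%:E)%E by rewrite EFin_Rintegral.
have gi0 : 0 <= g^-1 by rewrite invr_ge0 ltW.
apply: (@prob_near_ge_of_density _ _ _ _ _ _ psi_pos X_iid phi 1 c y z).
- by apply: measurable_funM.
- by move=> u; rewrite mulr_ge0.
- by [].
- rewrite ge0_integral_EFinZ// gE -EFinM mulVf// gt_eqF//.
- have : (\int[psi]_u (g^-1 * (expR (K%:R + K%:R) * weight c z K y u))%:E < +oo)%E.
    rewrite ge0_integral_EFinZ//; last 2 first.
    + by apply: measurable_funM.
    + by move=> u; apply: mulr_ge0; rewrite ?expR_ge0 ?w0.
    rewrite ge0_integral_EFinZ ?expR_ge0// gE -!EFinM ltry//.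
  apply: le_lt_trans; apply: ge0_integral_EFin_le.
  + apply: measurable_funM; first exact: measurable_funM.
    exact: measurable_exp_abs.
  + by apply: measurable_funM => //; apply: measurable_funM.
  + by move=> u; rewrite /phi; apply: mulr_ge0; rewrite ?expR_ge0 ?mulr_ge0.
  move=> u; rewrite -mulrA ler_wpM2l// mulrC /weight indicE.
  case: (boolP (u \in box K)) => [/set_mem [u1 u2]|_]; last by rewrite !mul0r !mulr0.
  by rewrite !mul1r ler_wpM2r ?expR_ge0// ler_expR lerD.
- have := minimizer_mean0 c0 ymin => E.
  transitivity (g^-1 * \int[psi]_u (weight c z K y u * tilt_var z u)).
    rewrite -RintegralZl//; first by apply: eq_Rintegral => u _; rewrite /phi mulrA.
    exact: integrable_weight_tilt_var.
  by rewrite E mulr0.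
- by [].
- move=> u; rewrite /phi /weight.
  have e0 := expR_ge0 (c * u.1 + y * tilt_var z u).
  apply: (@le_trans _ _ (1 * (1 * expR (c * u.1 + y * tilt_var z u)))); last by rewrite !mul1r.
  apply: ler_pM => //; first by rewrite invf_le1// ltW.
  by rewrite ler_wpM2r// indicE; case: (_ \in _).
Qed.

End tilt_existence.

(** * Lower bound for open sets *)

Lemma oppe_le_gt (R : realType) (L x : \bar R) : (0 <= x)%E ->
  (forall c : R, (x < c%:E)%E -> ((- c)%:E <= L)%E) -> (- x <= L)%E.
Proof.
case: x => [r| |] // _ H; last by rewrite leNye.
apply/lee_subgt0Pr => e e0; have := H (r + e).
by rewrite lte_fin ltrDl => /(_ e0); rewrite opprD.
Qed.

Section lower.
Context (R : realType) d (Omega : measurableType d) (P : probability Omega R).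
Context (psi : probability (R * R)%type R).
Context (X : nat -> {RV P >-> (R * R)%type}).
Hypothesis psi_pos : psi (`]0, +oo[ `*` [set: R]) = 1%E.
Hypothesis X_iid : iid_with_law psi X.
Hypothesis theta0_gt0 : (0 < theta0 psi)%E.
Hypothesis eta0_gt0 : (0 < eta0 psi)%E.
Local Notation m := (mean_W psi / mean_tau psi).
Local Notation Z := (reward X).

Lemma prob_near_mean_ge (eps c : R) : 0 < eps -> 0 < c ->
  exists2 t0, 0 < t0 & forall t, t0 < t ->
    ((expR (- c * t))%:E <= P [set w | (`|Z t w / t - m| < eps)%R])%E.
Proof.
have [s s0 Es] := exp_moment psi_pos theta0_gt0 eta0_gt0.
have [it iW] := integrable_tau_W psi_pos theta0_gt0 eta0_gt0.
have t0 := mean_tau_gt0 psi_pos theta0_gt0 eta0_gt0.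
apply: (@prob_near_ge_of_density _ _ _ _ _ _ psi_pos X_iid (fun=> 1) s 0 0 m) => //.
- by rewrite EFin_Rintegral ?integrable1// Rintegral_cst1.
- by under eq_integral do rewrite mul1r.
- have [_ E] := integrable_lin 1 (- m) iW it.
  transitivity (\int[psi]_x (1 * x.2 + - m * x.1)).
    by apply: eq_Rintegral => u _; ring.
  by rewrite E -/(mean_W psi) -/(mean_tau psi); field; rewrite gt_eqF.
- by move=> u; rewrite !mul0r addr0 expR0.
Qed.

(** If W <= z' tau almost surely, the half-line of points (- z' k, k), k >= 0, is
    in the level set, and the cost is infinite beyond z'. If W >= z' tau almost
    surely, then m >= z'. Here z' lies strictly between z and m. *)
Lemma tilt_var_both_signs (z l : R) : z != m -> 0 < l < 1 -> (cost psi z < +oo)%E ->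
  forall sg : R, sg ^+ 2 = 1 ->
  ~ {ae psi, forall u, sg * tilt_var ((1 - l) * z + l * m) u <= 0}.
Proof.
move=> zm /andP[l0 l1] zoo sg sg2; set z' := _ + _ => ae_le.
have [it iW] := integrable_tau_W psi_pos theta0_gt0 eta0_gt0.
have t0 := mean_tau_gt0 psi_pos theta0_gt0 eta0_gt0.
have sgm : 0 <= sg * (z' - m).
  have [I E] := integrable_lin (- sg) (sg * z') iW it.
  have : 0 <= \int[psi]_x (- sg * x.2 + sg * z' * x.1).
    rewrite -lee_fin -EFin_Rintegral//.
    rewrite (@ae_eq_integral _ _ _ psi setT (fun u => `|- sg * u.2 + sg * z' * u.1|%:E))//.
    - by apply: integral_ge0 => u _; rewrite lee_fin.
    - exact: measurable_int I.
    - apply/measurable_EFinP; apply: measurableT_comp => //.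
      by apply/measurable_EFinP; exact: measurable_int I.
    apply: filterS ae_le => u; rewrite /tilt_var => Hu _; rewrite ger0_norm//.
    rewrite -oppr_le0; apply: le_trans Hu; rewrite le_eqVlt; apply/orP; left.
    by apply/eqP; ring.
  rewrite E -/(mean_W psi) -/(mean_tau psi) => h.
  have -> : sg * (z' - m) = (- sg * mean_W psi + sg * z' * mean_tau psi) / mean_tau psi.
    by field; rewrite gt_eqF.
  by rewrite divr_ge0// ltW.
have zz : z' - m = (1 - l) * (z - m) by rewrite /z'; ring.
have szm : 0 < sg * (z - m).
  have l1' : 0 < 1 - l by rewrite subr_gt0.
  rewrite lt_neqAle; apply/andP; split; last first.
    by move: sgm; rewrite zz mulrCA pmulr_rge0.
  rewrite eq_sym mulf_eq0 negb_or subr_eq0 zm andbT.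
  by apply/eqP => sg0; move: sg2; rewrite sg0 expr0n/= => /eqP; rewrite eq_sym oner_eq0.
case E : (cost psi z) zoo => [r| |] // _; last first.
  by have := cost_ge0 psi z; rewrite E.
(* the point of the half-line at which x + z y equals |r| + 1 *)
pose k := (`|r| + 1) / (l * (sg * (z - m))).
have k0 : 0 < k by rewrite divr_gt0 ?ltr_wpDl// mulr_gt0.
have M : (mgf psi (- (z' * (k * sg))) (k * sg) <= 1)%E.
  rewrite -(mgf00 psi); apply: ge0_integral_EFin_ae_le.
  - exact: measurable_explin.
  - exact: measurable_explin.
  - by move=> u; exact: expR_ge0.
  - by move=> u; exact: expR_ge0.
  apply: filterS ae_le => u Hu; rewrite ler_expR !mul0r addr0.
  have -> : - (z' * (k * sg)) * u.1 + k * sg * u.2 = k * (sg * tilt_var z' u).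
    by rewrite /tilt_var; ring.
  by rewrite pmulr_rle0.
have := cost_ge z M; rewrite E lee_fin.
have -> : - (z' * (k * sg)) + z * (k * sg) = k * (l * (sg * (z - m))).
  by rewrite /z'; ring.
rewrite /k divfK; last by rewrite gt_eqF// mulr_gt0.
apply/negP; rewrite -ltNge; have := ler_norm r; lra.
Qed.

(** Away from m, the target z is replaced by a nearby point between z and m,
    where the cost is no larger by convexity. *)
Lemma prob_near_ge (z eps c : R) : 0 < eps -> (cost psi z < c%:E)%E ->
  exists2 t0, 0 < t0 & forall t, t0 < t ->
    ((expR (- c * t))%:E <= P [set w | (`|Z t w / t - z| < eps)%R])%E.
Proof.
move=> e0 zc.
have [zm|zm] := eqVneq z m.
  rewrite zm; apply: prob_near_mean_ge => //.
  by rewrite -lte_fin; apply: le_lt_trans zc; exact: cost_ge0.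
have zoo := lt_trans zc (ltry c).
have c0 : 0 < c by rewrite -lte_fin; apply: le_lt_trans (cost_ge0 _ _) zc.
have [r [r0 zr rc]] : exists r, [/\ 0 <= r, (cost psi z <= r%:E)%E & r < c].
  have := cost_ge0 psi z; case E : (cost psi z) zc => [r| |]// rc r0.
  by exists r; split; rewrite // -lte_fin.
(* the tilt is taken at a level strictly between the cost and c *)
pose c1 := (r + c) / 2.
have rc1 : r < c1 by rewrite /c1; lra.
have c1c : c1 < c by rewrite /c1; lra.
have c10 : 0 <= c1 by rewrite /c1; lra.
pose k := 2 * (`|m - z| + 1).
have k0 : 0 < k by rewrite mulr_gt0// ltr_wpDl.
pose l := Num.min (2^-1) (eps / k).
have l0 : 0 < l by rewrite lt_min invr_gt0 ltr0n divr_gt0.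
have l1 : l <= 2^-1 by rewrite ge_min lexx.
have lk : l * k <= eps by rewrite -ler_pdivlMr// /l ge_min lexx orbT.
have l01 : 0 < l < 1 by rewrite l0/=; lra.
pose z' := (1 - l) * z + l * m.
have gt1 y : (1 < mgf psi (c1 - z' * y) y)%E.
  rewrite ltNge; apply/negP => M1.
  have h1 := le_trans (cost_ge z M1) zr.
  have h2 := mgf_le1_mean psi_pos theta0_gt0 eta0_gt0 M1.
  rewrite lee_fin in h1.
  have : (1 - l) * (c1 - z' * y + z * y) + l * (c1 - z' * y + m * y) = c1.
    by rewrite /z'; move: (m) => mm; ring.
  have : 0 <= 1 - l by lra.
  move=> l1'.
  have h3 := ler_wpM2l l1' h1.
  have h4 := ler_wpM2l (ltW l0) h2.
  have h5 : (1 - l) * r <= r by rewrite ler_piMl//; lra.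
  lra.
have e2 : 0 < eps / 2 by rewrite divr_gt0.
have signs := tilt_var_both_signs zm l01 zoo.
have [t0 t00 H] := prob_near_ge_of_tilt c10 gt1 signs psi_pos X_iid e2 c1c.
exists t0 => // t tt0; apply: le_trans (H t tt0) _.
apply: le_measure; rewrite ?inE//; try exact: measurable_velocity_near.
move=> w /= h.
have zz' : `|z' - z| <= eps / 2.
  have -> : z' - z = l * (m - z) by rewrite /z'; ring.
  rewrite normrM gtr0_norm//.
  rewrite /k in lk; lra.
have -> : Z t w / t - z = (Z t w / t - z') + (z' - z) by rewrite addrA subrK.
apply: le_lt_trans (ler_normD _ _) _; lra.
Qed.

Lemma ldp_lower_open (O : set R) : eta0 psi = +oo%E -> open O ->
  (- ereal_inf (Jbar psi @` O) <=
    liminf_log_prob P (fun t => (fun w => (Z t w / t)%R) @^-1` O))%E.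
Proof.
move=> etay oO.
have JE : Jbar psi = cost psi by apply/funext => z; exact: Jbar_cost.
rewrite JE; apply: oppe_le_gt.
  by apply: le_ereal_inf_tmp => _ [z _ <-]; exact: cost_ge0.
move=> c /ereal_inf_lt[_ [z Oz <-] zc].
have /nbhs_ballP[eps /= e0 He] := open_nbhs_nbhs (conj oO Oz).
have [t0 t00 H] := prob_near_ge e0 zc.
rewrite /liminf_log_prob limf_einfE.
apply: (@le_trans _ _ (ereal_inf (log_prob_rate P
    (fun t => (fun w => (Z t w / t)%R) @^-1` O) @` [set t | t0 < t]))); last first.
  apply: ereal_sup_ubound; exists [set t | t0 < t] => //.
  by exists t0; split => //; exact: num_real.
apply: le_ereal_inf_tmp => _ [t /= t0t <-].
have tpos : 0 < t by apply: lt_trans t0t.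
rewrite /log_prob_rate lee_pdivlMl//.
have mO : measurable ((fun w => Z t w / t) @^-1` O).
  rewrite -[_ @^-1` _]setTI; apply: measurable_velocity => //.
  exact: open_measurable.
apply: (@le_trans _ _ (lne (expR (- c * t))%:E)).
  by rewrite lne_EFin ?expR_gt0// expRK -EFinM lee_fin mulrC.
rewrite lee_lne; last 2 first.
- by rewrite in_itv/= leey lee_fin expR_ge0.
- by rewrite in_itv/= leey measure_ge0.
apply: le_trans (H t t0t) _.
apply: le_measure; rewrite ?inE//; first exact: measurable_velocity_near.
by move=> w /= h; apply: He; rewrite /ball/= distrC.
Qed.
End lower.

(** * The large deviation principle *)

Theorem theorem2p4 (R : realType) (d : measure_display)
    (Omega : measurableType d) (P : probability Omega R)
    (psi : probability (R * R)%type R)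
    (psi_pos : psi (`]0, +oo[ `*` [set: R]) = 1%E)
    (X : nat -> {RV P >-> (R * R)%type})
    (X_iid : iid_with_law psi X)
    (eta0_gt0 : (0 < eta0 psi)%E)
    (theta0_gt0 : (0 < theta0 psi)%E) :
  let Z := reward X in
  [/\ (* (i) *)
      eta0 psi = +oo%E ->
        full_LDP P (fun t w => Z t w / t) (Jbar psi) /\ good_rate (Jbar psi),
      (* the particular case of (i): W bounded *)
      (exists K : R, {ae psi, forall z, `|z.2| <= K}) -> eta0 psi = +oo%E &
      (* (ii) *)
      (eta0 psi < +oo)%E ->
        let m := fine 'E_psi[fun z => z.2] / fine 'E_psi[fun z => z.1] in
        forall a kappa : R, 0 < a -> 0 < kappa < 1 ->
          (limsup_log_prob P (fun t => [set w | (m + a <= Z t w / t)%R]) <=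
             - mine (ereal_inf [set Jbar psi z |
                                 z in [set z | (m + kappa * a <= z)%R]])
                    (eta0 psi * (a * (1 - kappa) / 4)%:E))%E /\
          (limsup_log_prob P (fun t => [set w | (Z t w / t <= m - a)%R]) <=
             - mine (ereal_inf [set Jbar psi z |
                                 z in [set z | (z <= m - kappa * a)%R]])
                    (eta0 psi * (a * (1 - kappa) / 4)%:E))%E].
Proof.
move=> Z.
have mE : fine 'E_psi[fun z => z.2] / fine 'E_psi[fun z => z.1] =
    mean_W psi / mean_tau psi by rewrite !expectationE.
have mZ t : measurable_fun setT (fun w => Z t w / t) := measurable_velocity X t.
split.
- move=> eta_y; have JE : Jbar psi = cost psi by apply/funext => z; exact: Jbar_cost.
  split; last by rewrite JE => a _; exact: cost_compact.
  split.
  + by move=> z; exact: Jbar_ge0.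
  + by rewrite JE; exact: cost_lower_semicontinuous.
  + by move=> O oO; exact: ldp_lower_open.
  + by move=> C cC; exact: ldp_upper_closed.
- by move=> [K WK]; exact: eta0_bounded WK.
move=> _ /=; rewrite mE; set m := _ / _ => a kappa a0 kappa01.
split.
- apply: (limsup_tail_le psi_pos X_iid theta0_gt0 eta0_gt0 (sg := 1)) => //.
  + by rewrite expr1n.
  + move=> t; rewrite (_ : [set w | _] = [set w | 0 <= 1 * (Z t w / t - (m + a))]).
      exact: measurable_affine_ge0.
    by apply/seteqP; split => w /=; rewrite mul1r subr_ge0.
  + by move=> t w t0 /=; rewrite -/m mul1r lerBrDl.
  + by move=> z /=; rewrite -/m mul1r lerBrDl.
- apply: (limsup_tail_le psi_pos X_iid theta0_gt0 eta0_gt0 (sg := -1)) => //.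
  + by rewrite sqrrN expr1n.
  + move=> t; rewrite (_ : [set w | _] = [set w | 0 <= -1 * (Z t w / t - (m - a))]).
      exact: measurable_affine_ge0.
    by apply/seteqP; split => w /=; rewrite mulN1r oppr_ge0 subr_le0.
  + by move=> t w t0 /=; rewrite -/m mulN1r opprB lerBrDr -lerBrDl.
  + by move=> z /=; rewrite -/m mulN1r opprB lerBrDr -lerBrDl.
Qed.
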